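(* Let $G$ be a primitive group of permutations of an infinite set $\Omega$ with more than one permutation-end and no infinite subdegree. Then $G$ has a locally finite orbital digraph $\Gamma$ with connectivity one, whose lobes are primitive but not automorphism-regular, are pairwise isomorphic, have at least three vertices and have at most one end. Furthermore, if $\Lambda$ is a lobe of $\Gamma$, then the setwise stabiliser $G_{\{\Lambda\}}$ acts primitively but not regularly on $V\Lambda$.
   Context: Permutations act on the right. A transitive permutation group $G$ on $\Omega$ is primitive if the only $G$-invariant equivalence relations on $\Omega$ are the trivial and universal ones. A transitive group acts regularly if all point stabilisers are trivial (for $G_{\{\Lambda\}}$ acting on $V\Lambda$, this refers to the permutation group induced on $V\Lambda$). The subdegrees of $G$ are the cardinalities of the orbits of the point stabilisers $G_\alpha$ on $\Omega$. A digraph $\Gamma=(V\Gamma,A\Gamma)$ has no loops and no multiple arcs; $A\Gamma$ is a set of ordered pairs of distinct vertices. Vertices $\alpha,\beta$ are adjacent if $(\alpha,\beta)$ or $(\beta,\alpha)$ lies in $A\Gamma$. All paths and connectedness are undirected. A digraph is locally finite if every vertex is adjacent to at most finitely many vertices. A digraph is primitive if its automorphism group is primitive on its vertex set, and automorphism-regular if its automorphism group acts regularly on its vertex set. For $\alpha,\beta\in\Omega$, the digraph $(\Omega,(\alpha,\beta)^G)$ with vertex set $\Omega$ and arc set the orbit $(\alpha,\beta)^G$ is an orbital digraph of $G$; it is non-diagonal if $\alpha\neq\beta$. A half-line is a one-way infinite cycle-free (undirected) path. Two half-lines are equivalent if there are infinitely many pairwise disjoint paths connecting a vertex of one to a vertex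 of the other; the equivalence classes are the ends. Finite digraphs have no ends. The connectivity of an infinite connected digraph $\Gamma$ is the smallest cardinality of a set $W\subseteq V\Gamma$ such that the induced digraph $\Gamma\setminus W$ is not connected. A lobe of $\Gamma$ is a connected subgraph that is maximal subject to having connectivity strictly greater than one (that is, a block in the usual sense: a maximal connected subgraph with at least two vertices and no cut vertex of its own). For a lobe $\Lambda$ of an orbital digraph of $G$, $G_{\{\Lambda\}}$ is the setwise stabiliser of $\Lambda$ (of $V\Lambda$) in $G$. If $G$ is primitive on the infinite set $\Omega$ and has no infinite subdegree, all non-diagonal orbital digraphs of $G$ are connected and locally finite, and the identity map on $\Omega$ induces natural bijections between their sets of ends. The permutation-ends of $G$ are the ends of any non-diagonal orbital digraph of $G$, under these identifications; so $G$ has more than one permutation-end if and only if one (equivalently, every) non-diagonal orbital digraph of $G$ has more than one end. *)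

(* Defs.v *)
From mathcomp Require Import all_boot.
From mathcomp Require Import boolp classical_sets functions cardinality.

Set Implicit Arguments.
Unset Strict Implicit.
Unset Printing Implicit Defensive.

Local Open Scope classical_set_scope.
Local Open Scope card_scope.

(* The image of x under the permutation g is written [g x]. *)
Definition permutation_group (T : Type) (G : set (T -> T)) : Prop :=
  [/\ forall g, G g -> bijective g,
      G id,
      forall g h, G g -> G h -> G (g \o h) &
      forall g h, G g -> cancel g h -> cancel h g -> G h].

(* For an action on a subset V, G is a set of maps sending V to itself, and
   the permutation group under consideration is the one it induces on V; the
   values of the maps outside V are irrelevant. *)
Definition transitive_on (T : Type) (G : set (T -> T)) (V : set T) : Prop :=
  forall x y, V x -> V y -> exists2 g, G g & g x = y.

Definition regular_on (T : Type) (G : set (T -> T)) (V : set T) : Prop :=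
  transitive_on G V /\
  forall x g, V x -> G g -> g x = x -> forall y, V y -> g y = y.

Definition equivalence_on (T : Type) (V : set T) (R : T -> T -> Prop) : Prop :=
  [/\ forall x, V x -> R x x,
      forall x y, V x -> V y -> R x y -> R y x &
      forall x y z, V x -> V y -> V z -> R x y -> R y z -> R x z].

Definition invariant_on (T : Type) (G : set (T -> T)) (V : set T)
    (R : T -> T -> Prop) : Prop :=
  forall g x y, G g -> V x -> V y -> R x y -> R (g x) (g y).

Definition primitive_on (T : Type) (G : set (T -> T)) (V : set T) : Prop :=
  transitive_on G V /\
  forall R : T -> T -> Prop, equivalence_on V R -> invariant_on G V R ->
    (forall x y, V x -> V y -> R x y -> x = y) \/
    (forall x y, V x -> V y -> R x y).

Definition point_stabiliser (T : Type) (G : set (T -> T)) (x : T)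
    : set (T -> T) :=
  [set g | G g /\ g x = x].

Definition set_stabiliser (T : Type) (G : set (T -> T)) (V : set T)
    : set (T -> T) :=
  [set g | G g /\ g @` V = V].

Definition orbit (T : Type) (G : set (T -> T)) (x : T) : set T :=
  [set g x | g in G].

Definition no_infinite_subdegree (T : Type) (G : set (T -> T)) : Prop :=
  forall x y, finite_set (orbit (point_stabiliser G x) y).

(* A digraph has its own vertex set inside the ambient type T, so that
   subgraphs of a digraph on T are again digraphs on T. *)
Record digraph (T : Type) := Digraph {
  vertices : set T;
  arcs : set (T * T);
  arcs_vertices : forall x y, arcs (x, y) -> vertices x /\ vertices y;
  arcs_loopless : forall x, ~ arcs (x, x) }.

Definition adjacent (T : Type) (D : digraph T) (x y : T) : Prop :=
  arcs D (x, y) \/ arcs D (y, x).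

Definition locally_finite (T : Type) (D : digraph T) : Prop :=
  forall x, vertices D x -> finite_set [set y | adjacent D x y].

Definition subdigraph (T : Type) (D E : digraph T) : Prop :=
  vertices D `<=` vertices E /\ arcs D `<=` arcs E.

Section Induced.
Variables (T : Type) (D : digraph T) (W : set T).

Let V := vertices D `\` W.
Let A := [set a | [/\ arcs D a, V a.1 & V a.2]].

Fact delete_arcs_vertices x y : A (x, y) -> V x /\ V y.
Proof. by case. Qed.

Fact delete_arcs_loopless x : ~ A (x, x).
Proof. by case=> Dxx _ _; exact: arcs_loopless Dxx. Qed.

(* The induced digraph D \ W. *)
Definition delete_vertices : digraph T :=
  Digraph delete_arcs_vertices delete_arcs_loopless.
End Induced.

(* The finite undirected path p 0, ..., p n (of length n); the values of p
   beyond n are irrelevant. *)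
Definition upath (T : Type) (D : digraph T) (n : nat) (p : nat -> T) : Prop :=
  (forall i, i <= n -> vertices D (p i)) /\
  (forall i, i < n -> adjacent D (p i) (p i.+1)).

Definition upath_vertices (T : Type) (n : nat) (p : nat -> T) : set T :=
  p @` `I_n.+1.

Definition connected_digraph (T : Type) (D : digraph T) : Prop :=
  forall x y, vertices D x -> vertices D y ->
    exists n p, [/\ upath D n p, p 0 = x & p n = y].

Definition separator (T : Type) (D : digraph T) (W : set T) : Prop :=
  W `<=` vertices D /\ ~ connected_digraph (delete_vertices D W).

(* The least cardinality of a separator is k.  For k > 0 this forces D to be
   connected, as the empty set is then not a separator. *)
Definition has_connectivity (T : Type) (D : digraph T) (k : nat) : Prop :=
  (exists W, separator D W /\ W #= `I_k) /\
  (forall W, separator D W -> `I_k #<= W).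

(* No separator has at most k vertices.  This also covers digraphs with no
   separator at all, such as finite complete graphs. *)
Definition connectivity_gt (T : Type) (D : digraph T) (k : nat) : Prop :=
  forall W, separator D W -> ~ (W #<= `I_k).

Definition block (T : Type) (D : digraph T) : Prop :=
  [/\ connected_digraph D, `I_2 #<= vertices D & connectivity_gt D 1].

Definition lobe (T : Type) (D L : digraph T) : Prop :=
  [/\ subdigraph L D, block L &
      forall L', subdigraph L' D -> block L' -> subdigraph L L' -> L' = L].

Definition isomorphism (T : Type) (D E : digraph T) (f : T -> T) : Prop :=
  set_bij (vertices D) (vertices E) f /\
  forall x y, vertices D x -> vertices D y ->
    arcs D (x, y) <-> arcs E (f x, f y).

Definition isomorphic (T : Type) (D E : digraph T) : Prop :=
  exists f, isomorphism D E f.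

Definition automorphisms (T : Type) (D : digraph T) : set (T -> T) :=
  [set f | isomorphism D D f].

Definition primitive_digraph (T : Type) (D : digraph T) : Prop :=
  primitive_on (automorphisms D) (vertices D).

Definition automorphism_regular (T : Type) (D : digraph T) : Prop :=
  regular_on (automorphisms D) (vertices D).

Definition half_line (T : Type) (D : digraph T) (r : nat -> T) : Prop :=
  injective r /\ forall i, adjacent D (r i) (r i.+1).

(* P k is the k-th path of an infinite disjoint family, and n k its length. *)
Definition half_line_equiv (T : Type) (D : digraph T) (r s : nat -> T) : Prop :=
  exists (n : nat -> nat) (P : nat -> nat -> T),
    (forall k, [/\ upath D (n k) (P k), range r (P k 0) &
                   range s (P k (n k))]) /\
    trivIset setT (fun k => upath_vertices (n k) (P k)).

Definition end_class (T : Type) (D : digraph T) (r : nat -> T)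
    : set (nat -> T) :=
  [set s | half_line D s /\ half_line_equiv D r s].

Definition ends (T : Type) (D : digraph T) : set (set (nat -> T)) :=
  [set end_class D r | r in half_line D].

Definition at_most_one_end (T : Type) (D : digraph T) : Prop :=
  is_subset1 (ends D).

Definition more_than_one_end (T : Type) (D : digraph T) : Prop :=
  exists e e', [/\ ends D e, ends D e' & e <> e'].

(* The non-diagonal orbital digraphs; the diagonal ones would have loops. *)
Definition orbital_digraph (T : Type) (G : set (T -> T)) (D : digraph T)
    : Prop :=
  vertices D = setT /\
  exists a b : T, a <> b /\ arcs D = [set (g a, g b) | g in G].

(* For G primitive on an infinite set and without infinite subdegree, all
   non-diagonal orbital digraphs have naturally corresponding ends, so it does
   not matter which of them is taken. *)
Definition more_than_one_permutation_end (T : Type) (G : set (T -> T))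
    : Prop :=
  exists D, orbital_digraph G D /\ more_than_one_end D.

(* Main.v *)
Require Import Defs.
From mathcomp Require Import all_boot.
From mathcomp Require Import boolp classical_sets functions cardinality.
From mathcomp Require Import finmap.

(** An edge cut of a connected graph is a vertex set with finite boundary that
    is infinite and has infinite complement.  A locally finite graph with
    several ends has such a cut ([ends_cut]).  Among the cuts with boundary as
    small as possible, those crossing the fewest others are pairwise nested
    ([optimal_nested], by uncrossing), and they are permuted by the
    automorphisms.  From this nested family one gets a pair [a], [b], a vertex
    [x] and a cut [C] such that no image of the pair under an automorphism is
    separated by [C], except for images containing [x] ([cut_pair]).  Thus
    [x] is a cut vertex of the graph spanned by the orbit of the pair [a], [b].

    The branches of a graph at [x] are the components left after deleting [x].
    In an orbital graph of a primitive group that has cut vertices, the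
    stabiliser of a lobe acts primitively on the lobe.  Indeed, the
    equivalence relation on the whole vertex set generated by the translates of
    an invariant relation on a lobe does not identify more vertices of this
    lobe than the relation does, as every other lobe is projected to one point
    ([lobe_relation]).  The action is not regular: otherwise the graph could be
    folded onto one lobe, translating each lobe by group elements, and the
    fibres of the folding would be blocks of imprimitivity
    ([lobe_not_regular]).  The same folding argument excludes lobes with two
    vertices ([lobe_three]).  It follows that a point stabiliser permutes the
    branches at its point transitively, so that every suborbit bounds their
    number ([branches_bound]).

    Hence there is an orbital graph with the largest possible number of
    branches at a vertex.  If one of its lobes had several ends, [cut_pair]
    applied to this lobe and its stabiliser would give a pair of vertices of the lobe
    whose orbit under the whole group spans a graph with more branches
    ([refine_lobe], [more_branches]).  So the lobes have at most one end.  The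
    maximal number of branches is at least two, for else the given orbital
    graph would be its own only lobe, and it has several ends.  *)

Set Implicit Arguments.
Unset Strict Implicit.
Unset Printing Implicit Defensive.

Local Open Scope classical_set_scope.
Local Open Scope card_scope.

(** * Walks *)

(** Walks are confined to a set [P], so that deleting vertices only changes
    [P]. *)
Inductive conn (T : Type) (A : T -> T -> Prop) (P : set T) : T -> T -> Prop :=
| conn_refl x : P x -> conn A P x x
| conn_step x y z : P x -> A x y -> conn A P y z -> conn A P x z.

Section Walks.
Variables (T : Type) (A : T -> T -> Prop).
Implicit Types (P Q : set T) (x y z : T).

Lemma conn_ends P x y : conn A P x y -> P x /\ P y.
Proof. by elim=> // {}x {}y z Px _ _ [_ Pz]. Qed.

Lemma conn_trans P x y z : conn A P x y -> conn A P y z -> conn A P x z.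
Proof.
by elim=> // {}x {}y y' Px Axy _ IH /IH; apply: conn_step.
Qed.

Lemma conn_edge P x y : P x -> P y -> A x y -> conn A P x y.
Proof. by move=> Px Py Axy; apply: conn_step Axy _ => //; apply: conn_refl. Qed.

Lemma conn_sub P Q x y :
  (forall z, P z -> Q z) -> conn A P x y -> conn A Q x y.
Proof.
move=> PQ; elim=> [z /PQ|u v w /PQ Qu Auv _]; first exact: conn_refl.
exact: conn_step.
Qed.

Lemma conn_invariant (Q : T -> Prop) P x y :
    (forall u v, P u -> P v -> A u v -> Q u -> Q v) ->
  conn A P x y -> Q x -> Q y.
Proof.
move=> step; elim=> // u v w Pu Auv vw IH Qu; apply: IH.
by apply: (step u) => //; case: (conn_ends vw).
Qed.

Lemma conn_sym P x y : (forall u v, A u v -> A v u) ->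
  conn A P x y -> conn A P y x.
Proof.
move=> Asym; elim=> [z|u v w Pu Auv vw IH]; first exact: conn_refl.
have [Pv _] := conn_ends vw.
by apply: conn_trans IH _; apply: conn_edge => //; apply: Asym.
Qed.

(** Cutting a walk at its first vertex outside [Q], so that the part before it
    is controlled. *)
Lemma conn_exit Q P x y : conn A P x y -> Q x -> ~ Q y ->
  exists u v, [/\ conn A (P `&` Q) x u, A u v, ~ Q v & conn A P v y].
Proof.
elim=> [z _ Qz /(_ Qz) //|u v w Pu Auv vw IH Qu nQw].
have [Qv|nQv] := pselect (Q v); last first.
  by exists u, v; split=> //; apply: conn_refl.
have [u' [v' [vu' Au'v' nQv' v'w]]] := IH Qv nQw.
exists u', v'; split=> //; apply: conn_step vu' => //.
Qed.

(** The edges of one walk serve for all [C] at once: this is why only finitely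
    many cuts of bounded size separate two vertices. *)
Lemma conn_crossing P x y : conn A P x y ->
  exists F : set (T * T), [/\ finite_set F,
    forall e, F e -> A e.1 e.2 /\ P e.1 &
    forall C : set T, C x -> ~ C y -> exists2 e, F e & C e.1 /\ ~ C e.2].
Proof.
elim=> [z _|u v w Pu Auv vw [F [finF FA Fcut]]].
  by exists set0; split=> // C Cz /(_ Cz).
exists ((u, v) |` F); split.
- by rewrite finite_setU; split=> //; apply: finite_set1.
- by move=> e [->|/FA].
move=> C Cu nCw; have [Cv|nCv] := pselect (C v).
  by have [e Fe Ce] := Fcut C Cv nCw; exists e => //; right.
by exists (u, v) => //; left.
Qed.

End Walks.

Lemma conn_map (T U : Type) (A : T -> T -> Prop) (B : U -> U -> Prop)
    (P : set T) (Q : set U) (f : T -> U) x y :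
    (forall u, P u -> Q (f u)) ->
    (forall u v, P u -> P v -> A u v -> conn B Q (f u) (f v)) ->
  conn A P x y -> conn B Q (f x) (f y).
Proof.
move=> PQ AB; elim=> [z /PQ|u v w Pu Auv vw]; first exact: conn_refl.
by apply: conn_trans; apply: AB => //; case: (conn_ends vw).
Qed.

Lemma conn_rel_sub (T : Type) (A B : T -> T -> Prop) (P Q : set T) x y :
    (forall u, P u -> Q u) ->
    (forall u v, P u -> P v -> A u v -> conn B Q u v) ->
  conn A P x y -> conn B Q x y.
Proof. exact: (@conn_map _ _ A B P Q id). Qed.

(** * Cardinalities of finite sets *)

Definition ncard (T : Type) (X : set T) : nat :=
  #|` fset_set (X : set {classic T})|.

Section FiniteCard.
Variable T : Type.
Implicit Types X Y A B : set T.

Lemma ncard_le X Y : X `<=` Y -> finite_set Y -> ncard X <= ncard Y.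
Proof.
move=> XY fY; have fX := sub_finite_set XY fY.
apply: fsubset_leq_card.
by rewrite -(@fset_set_sub {classic T} X Y).
Qed.

Lemma ncard_lt X Y c : X `<=` Y -> finite_set Y -> Y c -> ~ X c -> ncard X < ncard Y.
Proof.
move=> XY fY Yc nXc; have fX := sub_finite_set XY fY.
apply: fproper_ltn_card.
rewrite fproperE; apply/andP; split.
  by rewrite -(@fset_set_sub {classic T} X Y).
apply/negP; rewrite -(@fset_set_sub {classic T} Y X) // => YX.
exact: nXc (YX c Yc).
Qed.

Lemma ncard_setUI X Y : finite_set X -> finite_set Y ->
  ncard (X `|` Y) + ncard (X `&` Y) = ncard X + ncard Y.
Proof.
move=> fX fY; rewrite /ncard (@fset_setU {classic T}) // (@fset_setI {classic T}) //.
exact: cardfsUI.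
Qed.

(** For the boundaries of two sets and those of two opposite corners this is
    submodularity; it also compares the families of cuts crossed by them. *)
Lemma ncard_uncross X Y A B : finite_set A -> finite_set B ->
    X `|` Y `<=` A `|` B -> X `&` Y `<=` A `&` B ->
  ncard X + ncard Y <= ncard A + ncard B.
Proof.
move=> fA fB UU II.
have fAB : finite_set (A `|` B) by rewrite finite_setU.
have /[!finite_setU] -[fX fY] := sub_finite_set UU fAB.
rewrite -(ncard_setUI fX fY) -(ncard_setUI fA fB) leq_add //; apply: ncard_le => //.
by apply: sub_finite_set fA => x [].
Qed.

Lemma ncard_uncross_lt X Y A B c : finite_set A -> finite_set B ->
    X `|` Y `<=` A `|` B -> X `&` Y `<=` A `&` B ->
    A c -> ~ X c -> ~ Y c ->
  ncard X + ncard Y < ncard A + ncard B.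
Proof.
move=> fA fB UU II Ac nXc nYc.
have fAB : finite_set (A `|` B) by rewrite finite_setU.
have /[!finite_setU] -[fX fY] := sub_finite_set UU fAB.
rewrite -(ncard_setUI fX fY) -(ncard_setUI fA fB) -addSn leq_add //.
  by apply: (ncard_lt (c := c)) => //; [left|case].
by apply: ncard_le => //; apply: sub_finite_set fA => x [].
Qed.

End FiniteCard.

Lemma ncard_image_inj (T U : Type) (f : T -> U) (X : set T) :
  finite_set X -> injective f -> ncard (f @` X) = ncard X.
Proof.
move=> fX injf; rewrite /ncard.
rewrite (@fset_set_image {classic T} {classic U} f X) //.
by rewrite card_imfset.
Qed.

(** * Minimal cuts *)

Lemma argmin (U : Type) (P : U -> Prop) (f : U -> nat) :
  (exists u, P u) -> exists u, P u /\ forall v, P v -> f u <= f v.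
Proof.
move=> [u Pu].
have ex : exists n, `[< exists u, P u /\ f u = n >].
  by exists (f u); apply/asboolP; exists u.
have [n /asboolP[v [Pv <-]] vmin] := ex_minnP ex.
by exists v; split=> // w Pw; apply: vmin; apply/asboolP; exists w.
Qed.

Lemma minimal_set (U : Type) (S : set (set U)) :
  finite_set S -> S !=set0 ->
  exists2 C, S C & forall D, S D -> D `<=` C -> C `<=` D.
Proof.
move=> finS S0.
have [C [SC Cmin]] := argmin (fun C => ncard (S `&` [set D | D `<=` C])) S0.
exists C => // D SD DC; apply: contrapT => nCD.
have /(_ _ SD) := Cmin; rewrite leqNgt => /negP; apply.
apply: (ncard_lt (c := C)).
- by move=> F [SF FD]; split=> //; apply: subset_trans DC.
- by apply: sub_finite_set finS => F [].
- by split.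
- by case.
Qed.

(** Every edge is counted in both orientations, so that a set and its complement
    have the same boundary. *)
Definition boundary (T : Type) (E : T -> T -> Prop) (C : set T) : set (T * T) :=
  [set e | E e.1 e.2 /\ ~ (C e.1 <-> C e.2)].

Definition tight (T : Type) (E : T -> T -> Prop) (C : set T) : Prop :=
  (forall x y, C x -> C y -> conn E C x y) /\
  (forall x y, ~ C x -> ~ C y -> conn E (~` C) x y).

(** By induction on [n], deleting the edge.  If this disconnects [x] from [y],
    then [C] is the component of [x].  Otherwise [C] cuts one of the finitely
    many edges of a walk from [x] to [y], and its boundary has become smaller.
    *)
Lemma finite_tight_cuts n (T : Type) (E : T -> T -> Prop) x y :
    E x y -> finite_set [set C : set T |
    [/\ tight E C, finite_set (boundary E C), ncard (boundary E C) <= n, C x & ~ C y]].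
Proof.
elim: n E x y => [|n IHn] E x y Exy.
  rewrite (_ : [set _ | _] = set0) ?finite_set0 //.
  apply/seteqP; split=> // C [_ finC nC Cx nCy].
  have xyC : boundary E C (x, y) by split=> //= -[/(_ Cx)].
  suff : ncard (set0 : set (T * T)) < ncard (boundary E C).
    by move=> /leq_trans/(_ nC).
  by apply: (ncard_lt (c := (x, y))).
pose E' u v := E u v /\ ~ (u = x /\ v = y) /\ ~ (u = y /\ v = x).
have bd' C : C x -> ~ C y -> finite_set (boundary E C) ->
    ncard (boundary E C) <= n.+1 ->
    finite_set (boundary E' C) /\ ncard (boundary E' C) <= n.
  move=> Cx nCy finC nC.
  have sub : boundary E' C `<=` boundary E C by move=> e [[Ee _] Ce]; split.
  split; first exact: sub_finite_set sub finC.
  rewrite -ltnS; apply: leq_trans nC; apply: (ncard_lt (c := (x, y))) => //=.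
    by split=> //= -[/(_ Cx)].
  by move=> -[[_ [/= + _]] _]; apply.
have conn' C z w : C x -> ~ C y -> tight E C -> C z -> C w ->
    conn E' C z w.
  move=> Cx nCy [tC _] Cz Cw; apply: conn_rel_sub (tC _ _ Cz Cw) => //.
  move=> u v Cu Cv Euv; apply: conn_edge => //; split=> //.
  by split=> -[? ?]; subst.
have conn'' C z w : C x -> ~ C y -> tight E C -> ~ C z -> ~ C w ->
    conn E' (~` C) z w.
  move=> Cx nCy [_ tC] Cz Cw; apply: conn_rel_sub (tC _ _ Cz Cw) => //.
  move=> u v Cu Cv Euv; apply: conn_edge => //; split=> //.
  by split=> -[? ?]; subst.
have tight' C : C x -> ~ C y -> tight E C -> tight E' C.
  by move=> Cx nCy tC; split=> u v; [apply: conn'|apply: conn''].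
have [xy|nxy] := pselect (conn E' setT x y); last first.
  (* x y is a bridge, so the component of x is the only candidate *)
  apply: sub_finite_set (finite_set1 [set v | conn E' setT x v]).
  move=> C [tC finC nC Cx nCy] /=; apply/seteqP; split=> v.
    by move=> Cv; apply: conn_sub (conn' C x v Cx nCy tC Cx Cv).
  move=> /= xv; apply: contrapT => nCv; apply: nxy; apply: conn_trans xv _.
  by apply: conn_sub (conn'' C v y Cx nCy tC nCv nCy).
have [F [finF FE Fcut]] := conn_crossing xy.
apply: (@sub_finite_set _ _ (\bigcup_(e in F) [set C | [/\ tight E' C,
    finite_set (boundary E' C), ncard (boundary E' C) <= n, C e.1 & ~ C e.2]])).
  move=> C [tC finC nC Cx nCy]; have [e Fe [C1 C2]] := Fcut C Cx nCy.
  have [finC' nC'] := bd' C Cx nCy finC nC.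
  by exists e => //; split=> //; apply: tight'.
by apply: bigcup_finite => // e /FE[? _]; apply: IHn.
Qed.

Definition nested (T : Type) (C D : set T) : Prop :=
  [\/ C `<=` D, C `<=` ~` D, ~` C `<=` D | ~` C `<=` ~` D].

Lemma nested_sym (T : Type) (C D : set T) : nested C D -> nested D C.
Proof.
case=> s.
- by apply: Or44 => x nDx /s.
- by apply: Or42 => x Dx /s.
- by apply: Or43 => x nDx; apply: contrapT => /s.
- by apply: Or41 => x Dx; apply: contrapT => /s.
Qed.

Lemma nestedCl (T : Type) (C D : set T) : nested (~` C) D <-> nested C D.
Proof.
by rewrite /nested setCK; split; case=> ?;
  [apply: Or43|apply: Or44|apply: Or41|apply: Or42
  |apply: Or43|apply: Or44|apply: Or41|apply: Or42].
Qed.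

Lemma nestedCr (T : Type) (C D : set T) : nested C (~` D) <-> nested C D.
Proof.
by split=> /nested_sym; [move/nestedCl/nested_sym|
   move=> h; apply/nested_sym/nestedCl].
Qed.

Definition automorphism (T : Type) (E : T -> T -> Prop) (h : T -> T) : Prop :=
  exists k, [/\ cancel h k, cancel k h & forall x y, E (h x) (h y) <-> E x y].

Section Cuts.
Variables (T : Type) (E : T -> T -> Prop).
Hypothesis Esym : forall x y, E x y -> E y x.
Hypothesis Econn : forall x y, conn E setT x y.
Implicit Types (C D F : set T).

Let bd := boundary E.

Definition infinite_cut C : Prop :=
  [/\ infinite_set C, infinite_set (~` C) & finite_set (boundary E C)].

Lemma boundaryC C : bd (~` C) = bd C.
Proof.
apply/seteqP; split=> e [Ee nC]; split=> //; rewrite /setC /= in nC *;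
  have [c1|c1] := pselect (C e.1); have [c2|c2] := pselect (C e.2); tauto.
Qed.

Lemma infinite_cutC C : infinite_cut C -> infinite_cut (~` C).
Proof.
by case=> iC iC' fC; split; rewrite ?setCK // -/(bd _) boundaryC.
Qed.

Lemma boundary_neq0 C x y : C x -> ~ C y -> exists e, bd C e /\ C e.1.
Proof.
move=> Cx nCy; have [F [_ FE Fcut]] := conn_crossing (Econn x y).
have [e Fe [C1 C2]] := Fcut C Cx nCy.
by exists e; split=> //; split; [case: (FE e Fe)|move=> [/(_ C1)]].
Qed.

Variable k : nat.
Hypothesis kmin : forall C, infinite_cut C -> k <= ncard (bd C).

Definition min_cut C : Prop := infinite_cut C /\ ncard (bd C) <= k.

Lemma min_cutC C : min_cut C -> min_cut (~` C).
Proof. by case=> iC nC; split; [exact: infinite_cutC|rewrite boundaryC]. Qed.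

(** Otherwise a component of [C] and the rest of [C] both have non-empty
    boundaries, which are disjoint and contained in that of [C]; so one of the
    two is an infinite cut with a smaller boundary. *)
Lemma min_cut_connected C : min_cut C ->
  forall x y, C x -> C y -> conn E C x y.
Proof.
move=> [[iC iC' fC] nC] x y Cx Cy; apply: contrapT => nxy.
pose C1 := [set z | conn E C x z]; pose C2 := C `\` C1.
have C1C : C1 `<=` C by move=> z xz; case: (conn_ends xz).
have E12 u v : E u v -> C1 u -> C v -> C1 v.
  move=> Euv xu Cv; have Cu := C1C _ xu.
  by apply: conn_trans xu _; apply: conn_edge.
have b1 : bd C1 `<=` bd C.
  move=> [u v] [/= Euv nC1]; split=> //= -[Cuv Cvu]; apply: nC1; split=> Hc.
    by apply: (E12 u v) => //; apply/Cuv/C1C.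
  by apply: (E12 v u) => //; [apply: Esym|apply/Cvu/C1C].
have b2 : bd C2 `<=` bd C.
  move=> [u v] [/= Euv nC2]; split=> //= -[Cuv Cvu]; apply: nC2.
  split=> -[Cu nC1]; split; [exact: Cuv| |exact: Cvu|].
    by move=> C1v; apply: nC1; apply: (E12 v u) => //; apply: Esym.
  by move=> C1v; apply: nC1; apply: (E12 u v).
have [z nCz] := infinite_setN0 iC'.
have C1x : C1 x by apply: conn_refl.
have C2y : C2 y by split.
have nC1z : ~ C1 z by move=> /C1C.
have nC2z : ~ C2 z by case.
have [e1 [be1 Ce1]] := boundary_neq0 C1x nC1z.
have [e2 [be2 Ce2]] := boundary_neq0 C2y nC2z.
have small C' e : C' `<=` C -> bd C' `<=` bd C -> bd C e -> ~ bd C' e ->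
    infinite_set C' -> False.
  move=> C'C sub be nbe iC''.
  have : infinite_cut C'.
    split=> //; first by apply: sub_infinite_set iC' => w nCw /C'C.
    exact: sub_finite_set sub fC.
  move/kmin; rewrite leqNgt => /negP; apply; apply: leq_trans nC.
  exact: (ncard_lt (c := e)).
(* the edges leaving one part do not leave the other *)
have n12 e : bd C1 e -> ~ bd C2 e.
  move=> [Ee nb1] [_ nb2]; have [_ nb] : bd C e by apply: b1; split.
  have := E12 _ _ Ee; have := E12 _ _ (Esym Ee).
  move: nb1 nb2 nb; rewrite /C2 /=; move: (C1C e.1) (C1C e.2).
  by have [c1|c1] := pselect (C e.1); have [c2|c2] := pselect (C e.2);
     have [d1|d1] := pselect (C1 e.1); have [d2|d2] := pselect (C1 e.2); tauto.
have [f1|i1] := pselect (finite_set C1); last first.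
  apply: (small C1 e2) => //; first exact: b2.
  by move=> /n12.
apply: (small C2 e1) => //; first by move=> ? [].
- exact: b1.
- exact: n12.
- exact: infinite_setD.
Qed.

Lemma min_cut_tight C : min_cut C -> tight E C.
Proof.
move=> mC; split; first exact: min_cut_connected.
exact: (min_cut_connected (min_cutC mC)).
Qed.

Lemma min_cuts_separating_finite x y :
  finite_set [set C | [/\ min_cut C, C x & ~ C y]].
Proof.
have [F [finF FE Fcut]] := conn_crossing (Econn x y).
apply: (@sub_finite_set _ _ (\bigcup_(e in F) [set C | [/\ tight E C,
    finite_set (bd C), ncard (bd C) <= k, C e.1 & ~ C e.2]])).
  move=> C [mC Cx nCy]; have [e Fe [C1 C2]] := Fcut C Cx nCy.
  exists e => //; split=> //; first exact: min_cut_tight.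
    by case: mC => -[].
  by case: mC.
by apply: bigcup_finite => // e /FE[Ee _]; apply: finite_tight_cuts.
Qed.

Definition crossing C : set (set T) := [set D | min_cut D /\ ~ nested C D].

(** A minimal cut [D] not nested with [C] separates two endpoints of boundary
    edges of [C]: otherwise [D] or its complement, being connected, could not
    leave the side of [C] it meets. *)
Lemma crossing_finite C : finite_set (bd C) -> finite_set (crossing C).
Proof.
move=> finC.
pose V := [set e.1 | e in bd C].
have finV : finite_set V by apply: finite_image.
have bdV u v : E u v -> ~ V u -> (C u <-> C v).
  move=> Euv nVu; apply: contrapT => nC; apply: nVu.
  by exists (u, v).
apply: (@sub_finite_set _ _ (\bigcup_(e in V `*` V)
    [set D | [/\ min_cut D, D e.1 & ~ D e.2]])); last first.
  apply: bigcup_finite => [|e _]; first exact: finite_setX.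
  exact: min_cuts_separating_finite.
move=> D [mD nCD]; apply: contrapT => nsep.
(* both D and its complement contain an endpoint of a boundary edge of C *)
have side D' : min_cut D' -> ~ nested C D' -> exists2 v, V v & D' v.
  move=> mD' nn; apply: contrapT => nV.
  have nV' v : D' v -> ~ V v by move=> Dv Vv; apply: nV; exists v.
  have cst u v : D' u -> D' v -> (C u -> C v).
    move=> Du Dv; apply: (@conn_invariant _ E C D' u v).
      by move=> a b Da _ Eab Ca; apply/(bdV _ _ Eab) => //; apply: nV'.
    exact: min_cut_connected.
  apply: nn; have [[u [Du Cu]]|nDC] := pselect (exists u, D' u /\ C u).
    by apply: Or44 => w nCw Dw; apply: nCw; apply: cst Cu.
  by apply: Or42 => w Cw Dw; apply: nDC; exists w.
have [v Vv Dv] := side D mD nCD.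
have [w Vw nDw] : exists2 v, V v & (~` D) v.
  by apply: side; [apply: min_cutC|rewrite nestedCr].
by apply: nsep; exists (v, w).
Qed.

Lemma min_cut_crossing_finite C : min_cut C -> finite_set (crossing C).
Proof. by case=> -[_ _ fC] _; apply: crossing_finite. Qed.

Lemma crossingC C : crossing (~` C) = crossing C.
Proof.
by apply/seteqP; split=> D [mD nD]; split=> //; move: nD; rewrite nestedCl.
Qed.

(** Uncrossing: by submodularity of the boundary, two opposite infinite
    corners of crossing minimal cuts are again minimal cuts, and they cross
    fewer minimal cuts altogether. *)
Lemma uncross C D : min_cut C -> min_cut D -> ~ nested C D ->
    infinite_set (C `&` D) -> infinite_set (~` C `&` ~` D) ->
  [/\ min_cut (C `&` D), min_cut (~` C `&` ~` D) &
      ncard (crossing (C `&` D)) + ncard (crossing (~` C `&` ~` D))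
        < ncard (crossing C) + ncard (crossing D)].
Proof.
move=> mC mD nCD i1 i2.
have [[iC iC' fC] nC] := mC; have [[iD iD' fD] nD] := mD.
set X := C `&` D; set Y := ~` C `&` ~` D.
have UU : bd X `|` bd Y `<=` bd C `|` bd D.
  move=> e [] [Ee]; rewrite /X /Y /bd /boundary /setC /setI /setU /mkset /= => ne;
  have [c1|c1] := pselect (C e.1); have [c2|c2] := pselect (C e.2);
  have [d1|d1] := pselect (D e.1); have [d2|d2] := pselect (D e.2); tauto.
have II : bd X `&` bd Y `<=` bd C `&` bd D.
  move=> e [] [Ee]; rewrite /X /Y /bd /boundary /setC /setI /setU /mkset /= => ne [_ nf];
  have [c1|c1] := pselect (C e.1); have [c2|c2] := pselect (C e.2);
  have [d1|d1] := pselect (D e.1); have [d2|d2] := pselect (D e.2); tauto.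
have : finite_set (bd X `|` bd Y).
  by apply: sub_finite_set UU _; rewrite finite_setU.
rewrite finite_setU => -[fX fY].
have cX : infinite_cut X.
  by split=> //; apply: sub_infinite_set iC' => x nCx [/nCx].
have cY : infinite_cut Y.
  by split=> //; apply: sub_infinite_set iC => x Cx [nCx _]; apply: nCx.
have le : ncard (bd X) + ncard (bd Y) <= k + k.
  by apply: leq_trans (leq_add nC nD); apply: ncard_uncross.
have kX := kmin cX; have kY := kmin cY.
have mX : min_cut X.
  split=> //; rewrite -(leq_add2r k); apply: leq_trans le.
  by rewrite leq_add2l.
have mY : min_cut Y.
  split=> //; rewrite -(leq_add2l k); apply: leq_trans le.
  by rewrite leq_add2r.
split=> //.
have dec (P : Prop) : P \/ ~ P by have [|] := pselect P; tauto.
apply: (ncard_uncross_lt (c := D)).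
- exact: min_cut_crossing_finite.
- exact: min_cut_crossing_finite.
- (* a cut nested with C and D is nested with both corners *)
  suff h F : nested C F -> nested D F -> nested X F /\ nested Y F.
    move=> F HF; have mF : min_cut F by case: HF => -[].
    have nn : ~ (nested X F /\ nested Y F) by case: HF => -[_ nF] [].
    have [n1|n1] := dec (nested C F); last by left; split.
    have [n2|n2] := dec (nested D F); last by right; split.
    by case: nn; apply: h.
  have aux P Q : ~ nested P Q -> nested P F -> nested Q F -> nested (P `&` Q) F.
    move=> nPQ [] sP.
    + by move=> _; apply: Or41 => x [/sP].
    + by move=> _; apply: Or42 => x [/sP].
    + case=> sQ.
      * by apply: Or41 => x [_ /sQ].
      * by apply: Or42 => x [_ /sQ].
      * apply: Or43 => x nPQx; apply: contrapT => nFx; apply: nPQx.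
        by split; apply: contrapT; [move=> /sP|move=> /sQ].
      * exfalso; apply: nPQ; apply: Or43 => x nPx.
        by apply: contrapT => /sQ; apply; apply: sP.
    + case=> sQ.
      * by apply: Or41 => x [_ /sQ].
      * by apply: Or42 => x [_ /sQ].
      * exfalso; apply: nPQ; apply: Or43 => x nPx.
        by apply: contrapT => /sQ; apply: sP.
      * apply: Or44 => x nPQx Fx; apply: nPQx.
        by split; apply: contrapT; [move=> /sP|move=> /sQ].
  move=> n1 n2; split; first exact: aux.
  by apply: aux; rewrite ?nestedCl ?nestedCr.
- (* a cut nested with C is nested with one of the corners *)
  move=> F [[mF n1] [_ n2]]; split; split=> // -[] s.
  + by apply: n1; apply: Or41 => x [/s].
  + by apply: n1; apply: Or42 => x [/s].
  + by apply: n2; apply: Or41 => x [/s].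
  + by apply: n2; apply: Or42 => x [/s].
  + by apply: n1; apply: Or41 => x [_ /s].
  + by apply: n1; apply: Or42 => x [_ /s].
  + by apply: n2; apply: Or41 => x [_ /s].
  + by apply: n2; apply: Or42 => x [_ /s].
- by split.
- by case=> _; apply; apply: Or41 => x [].
- by case=> _; apply; apply: Or42 => x [].
Qed.

Definition optimal C : Prop :=
  min_cut C /\ forall D, min_cut D -> ncard (crossing C) <= ncard (crossing D).

Lemma optimalC C : optimal C -> optimal (~` C).
Proof. by case=> mC opt; split; [exact: min_cutC|rewrite crossingC]. Qed.

(** If [C] and [D] cross, then in one of the two pairs of opposite corners both
    corners are infinite, and one of them would cross fewer minimal cuts. *)
Lemma optimal_nested C D : optimal C -> optimal D -> nested C D.
Proof.
move=> oC oD; apply: contrapT => nCD.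
have no D' : optimal D' -> ~ nested C D' ->
    infinite_set (C `&` D') -> infinite_set (~` C `&` ~` D') -> False.
  move=> [mD' oD'] nCD' i1 i2; have [mC optC] := oC.
  have [mX mY] := uncross mC mD' nCD' i1 i2.
  rewrite ltnNge; case/negP; by apply: leq_add; [apply: optC|apply: oD'].
have [mC _] := oC; have [mD _] := oD.
have [[iC iC' _] _] := mC; have [[iD iD' _] _] := mD.
have splitC F : infinite_set F -> finite_set (F `&` D) ->
    infinite_set (F `&` ~` D).
  move=> iF fF fF'; apply: iF; rewrite -[F](setIT) -(setUCr D) setIUr.
  by rewrite finite_setU.
have splitC' F : infinite_set F -> finite_set (F `&` ~` D) ->
    infinite_set (F `&` D).
  by move=> iF fF /(splitC _ iF)/(_ fF).
have [f1|i1] := pselect (finite_set (C `&` D)).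
  apply: (no (~` D)); rewrite ?nestedCr ?setCK //; first exact: optimalC.
    exact: splitC.
  move=> f2; apply: iD; rewrite -[D](setIT) -(setUCr C) setIUr finite_setU.
  by rewrite setIC [D `&` ~` _]setIC.
have [f2|i2] := pselect (finite_set (~` C `&` ~` D)); last exact: (no D).
apply: (no (~` D)); rewrite ?nestedCr ?setCK //; first exact: optimalC.
  move=> f3; apply: iD'; rewrite -[~` D](setIT) -(setUCr C) setIUr finite_setU.
  by rewrite setIC [~` D `&` ~` _]setIC.
exact: splitC'.
Qed.

Section Automorphisms.
Variables h h' : T -> T.
Hypotheses (hK : cancel h h') (h'K : cancel h' h).
Hypothesis Eh : forall x y, E (h x) (h y) <-> E x y.

Lemma min_cut_preimage C : min_cut C -> min_cut (h @^-1` C).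
Proof.
move=> [[iC iC' fC] nC].
have pre F : finite_set (h @^-1` F) -> finite_set F.
  move=> fF; apply: sub_finite_set (finite_image h fF) => x Fx.
  by exists (h' x); rewrite /preimage /= h'K.
have sub : (fun e => (h e.1, h e.2)) @` (bd (h @^-1` C)) `<=` bd C.
  by move=> _ [[u v] [Euv nuv] <-]; split=> //=; apply/Eh.
have inj : injective (fun e : T * T => (h e.1, h e.2)).
  by move=> [u v] [u1 v1] [/(can_inj hK)-> /(can_inj hK)->].
have fin : finite_set (bd (h @^-1` C)).
  have := finite_preimage (f := fun e => (h e.1, h e.2))
    (fun _ _ _ _ => @inj _ _) fC.
  by apply: sub_finite_set => e be; apply: sub; exists e.
split; last by rewrite -(ncard_image_inj fin inj); apply: leq_trans nC; apply: ncard_le.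
split=> //; first by move=> /pre.
by rewrite preimage_setC => /pre.
Qed.

End Automorphisms.

Lemma nested_preimage (h h' : T -> T) C D : cancel h' h ->
  nested (h @^-1` C) (h @^-1` D) -> nested C D.
Proof.
move=> h'K; have sub (P Q : set T) : h @^-1` P `<=` h @^-1` Q -> P `<=` Q.
  by move=> PQ x Px; rewrite -(h'K x); apply: PQ; rewrite /preimage /= h'K.
case=> s.
- by apply: Or41; apply: (sub C D).
- by apply: Or42; apply: (sub C (~` D)).
- by apply: Or43; apply: (sub (~` C) D).
- by apply: Or44; apply: (sub (~` C) (~` D)).
Qed.

Lemma optimal_preimage (h h' : T -> T) C :
    cancel h h' -> cancel h' h -> (forall x y, E (h x) (h y) <-> E x y) ->
  optimal C -> optimal (h @^-1` C).
Proof.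
move=> hK h'K Eh [mC oC].
have Eh' x y : E (h' x) (h' y) <-> E x y by rewrite -Eh !h'K.
have mhC := min_cut_preimage hK h'K Eh mC.
split=> // D mD; apply: leq_trans (oC D mD).
have hh' F : h' @^-1` (h @^-1` F) = F.
  by apply/seteqP; split=> x; rewrite /preimage /= h'K.
have inj : injective (fun F : set T => h' @^-1` F).
  move=> F F' /= eqF; apply/funext=> x.
  by rewrite -(hK x) -[LHS]/((h' @^-1` F) (h x)) eqF.
rewrite -(ncard_image_inj (min_cut_crossing_finite mhC) inj).
apply: ncard_le; last exact: min_cut_crossing_finite.
move=> _ [F [mF nF] <-]; split; first exact (min_cut_preimage h'K hK Eh' mF).
by rewrite -{1}(hh' C) => /(nested_preimage hK).
Qed.

End Cuts.

(** Take an optimal cut [C] that is minimal among those containing a point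
    [x], and a pair [a], [b] separated by as few optimal cuts as possible.  If
    [C] separates [h a] from [h b], with [h a] in [C], say, then every optimal
    cut separating [x] from [h a] also separates [h a] from [h b], as it is
    nested with [C] and [C] is minimal.  As [C] itself does not separate [x]
    from [h a], the choice of [a], [b] forces [x = h a]. *)
Lemma cut_pair (T : Type) (E : T -> T -> Prop) :
    (forall x y, E x y -> E y x) -> (forall x y, conn E setT x y) ->
    (exists C, infinite_cut E C) ->
  exists a b x (C : set T), [/\ a <> b, C x, exists2 y, C y & y <> x,
    exists z, ~ C z &
    forall h, automorphism E h -> ~ (C (h a) <-> C (h b)) -> x = h a \/ x = h b].
Proof.
move=> Esym Econn cut.
have [C0 [iC0 kmin]] := argmin (fun C => ncard (boundary E C)) cut.
set k := ncard (boundary E C0) in kmin.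
have [C1 [mC1 C1opt]] : exists C, optimal E k C.
  by apply: argmin; exists C0; split.
have [[iC1 iC1' _] _] := mC1.
have [x C1x] := infinite_setN0 iC1; have [z nC1z] := infinite_setN0 iC1'.
(* the bound by C1 leaves finitely many candidates: they separate x from z *)
have [||C [oC Cx CC1] Cmin] :=
    @minimal_set _ [set C | [/\ optimal E k C, C x & C `<=` C1]].
- apply: sub_finite_set (min_cuts_separating_finite Esym Econn kmin x z).
  by move=> C [[mC _] Cx CC1]; split=> // /CC1.
- by exists C1; split.
have iC : infinite_set C by case: oC => -[[]].
have [y [Cy yx]] : exists y, C y /\ y <> x.
  have [y [Cy nyx]] := infinite_setN0 (infinite_setD iC (finite_set1 x)).
  by exists y.
pose sep (p : T * T) :=
  [set D | optimal E k D /\ (D p.1 /\ ~ D p.2 \/ D p.2 /\ ~ D p.1)].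
have sep_finite p : finite_set (sep p).
  apply: (@sub_finite_set _ _
    ([set D | [/\ min_cut E k D, D p.1 & ~ D p.2]] `|`
     [set D | [/\ min_cut E k D, D p.2 & ~ D p.1]])).
    by move=> D [[mD _] [[? ?]|[? ?]]]; [left|right].
  by rewrite finite_setU; split; apply: min_cuts_separating_finite.
have [] := argmin (P := fun p => p.1 <> p.2) (fun p => ncard (sep p)).
  by exists (x, y) => /= /esym.
move=> [a b] [/= ab abmin].
exists a, b, x, C; split=> //; first by exists y.
  by exists z => /CC1.
move=> h [h' [hK h'K Eh]].
suff key a' b' : (forall p, p.1 <> p.2 -> ncard (sep (a', b')) <= ncard (sep p)) ->
    C (h a') -> ~ C (h b') -> x = h a'.
  move=> nab; have [Ca|nCa] := pselect (C (h a)).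
    by left; apply: (key a b) => // Cb; apply: nab.
  right; apply: (key b a) => //.
    have -> : sep (b, a) = sep (a, b).
      by apply/seteqP; split=> D [oD /= H]; split=> //=; tauto.
    by move=> p /abmin.
  by apply: contrapT => nCb; apply: nab.
move=> min Ca nCb; apply: contrapT => xa.
set p := h' x; set D := h @^-1` C.
have oD : optimal E k D by apply: (optimal_preimage Esym Econn kmin hK h'K Eh oC).
have pa : (a', p).1 <> (a', p).2.
  by rewrite /= /p => ap; apply: xa; rewrite ap h'K.
have Dp : D p by rewrite /D /preimage /= h'K.
(* the minimality of C, translated by h *)
have Dmin F : optimal E k F -> F p -> F `<=` D -> D `<=` F.
  move=> oF Fp FD.
  have s : C `<=` h' @^-1` F.
    apply: Cmin.
      split=> //; last first.
        by move=> w /FD; rewrite /D /preimage /= h'K => /CC1.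
      apply: (optimal_preimage Esym Econn kmin h'K hK _ oF) => // u v.
      by rewrite -Eh !h'K.
    by move=> w /FD; rewrite /D /preimage /= h'K.
  by move=> w /s; rewrite /preimage /= hK.
have := min _ pa; rewrite leqNgt => /negP; apply.
(* cuts separating p from a' separate a' from b' *)
have side F : optimal E k F -> F p -> ~ F a' -> F b'.
  move=> oF Fp nFa; apply: contrapT => nFb.
  case: (optimal_nested Esym Econn kmin oF oD) => s.
  - by apply: nFa; apply: Dmin s _ _.
  - exact: s Dp.
  - by apply: nCb; apply: (s b').
  - by apply: (s a').
apply: (ncard_lt (c := D)) => //.
- move=> F [oF /= [[Fa nFp]|[Fp nFa]]]; split=> //=.
    left; split=> // Fb.
    exact: (side (~` F) (optimalC oF) nFp (fun n => n Fa) Fb).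
  by right; split=> //; apply: side.
- by split=> //; left.
- by case=> _ /= [[_ /(_ Dp)]|[_ /(_ Ca)]].
Qed.

(** * Lobes of a connected graph *)

Section Lobes.
Variables (T : Type) (A : T -> T -> Prop).
Implicit Types (L M : set T) (u v w x y z : T).

(** [y] and [z] lie in the same branch at [x]. *)
Definition off x y z : Prop := conn A (~` [set x]) y z.

Definition colobal x y : Prop :=
  x <> y /\ forall z, z <> x -> z <> y -> off z x y.

Definition lobe_through x y : set T :=
  [set z | [\/ z = x, z = y | colobal z x /\ colobal z y]].

(** In a connected graph the blocks are the maximal cliques of [colobal]; each
    is determined by any two of its vertices. *)
Definition is_lobe L : Prop := exists x y, colobal x y /\ L = lobe_through x y.

(** [u] is the vertex of [L] at which the part of the graph containing [w] hangs
    on [L]. *)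
Definition prj L w u : Prop := L u /\ conn A [set z | z = u \/ ~ L z] w u.

Hypothesis Asym : forall x y, A x y -> A y x.
Hypothesis Airr : forall x, ~ A x x.
Hypothesis Aconn : forall x y, conn A setT x y.

Lemma adj_neq x y : A x y -> x <> y.
Proof. by move=> Axy exy; move: Axy; rewrite exy; apply: Airr. Qed.

Lemma off_refl x y : y <> x -> off x y y.
Proof. by move=> yx; apply: conn_refl. Qed.

Lemma off_sym x y z : off x y z -> off x z y.
Proof. exact: conn_sym. Qed.

Lemma off_trans x y z w : off x y z -> off x z w -> off x y w.
Proof. exact: conn_trans. Qed.

Lemma off_edge x y z : y <> x -> z <> x -> A y z -> off x y z.
Proof. by move=> yx zx Ayz; apply: conn_edge. Qed.

Lemma adj_colobal x y : A x y -> colobal x y.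
Proof.
move=> Axy; split=> [|z zx zy]; first exact: adj_neq.
by apply: off_edge => // /esym.
Qed.

(** Each of [x] and [y] connects [z] to [w] off any vertex but itself, and no
    vertex is equal to both. *)
Lemma lob_clique x y z w : colobal x y -> lobe_through x y z -> lobe_through x y w ->
  z <> w -> colobal z w.
Proof.
move=> xy Lz Lw zw; split=> // t tz tw.
have near u : lobe_through x y u -> t <> u -> t <> x -> off t u x.
  case=> [->|->|[[_ ux] _]] tu tx; first by apply: off_refl => /esym.
    by have [_ h] := xy; apply/off_sym/h.
  by apply: ux.
have near' u : lobe_through x y u -> t <> u -> t <> y -> off t u y.
  case=> [->|->|[_ [_ uy]]] tu ty; last by apply: uy.
    by have [_ h] := xy; apply: h.
  by apply: off_refl => /esym.
have [tx|tx] := pselect (t = x); last first.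
  by apply: off_trans (near z Lz tz tx) _; apply/off_sym/near.
have ty : t <> y by have [xy' _] := xy; rewrite tx.
by apply: off_trans (near' z Lz tz ty) _; apply/off_sym/near'.
Qed.

Lemma lob_eq x y z w : colobal x y -> lobe_through x y z -> lobe_through x y w ->
  z <> w -> lobe_through x y = lobe_through z w.
Proof.
move=> xy Lz Lw zw; have czw := lob_clique xy Lz Lw zw.
have mem a b p q c : colobal a b -> lobe_through a b p -> lobe_through a b q ->
    lobe_through a b c -> lobe_through p q c.
  move=> ab Lp Lq Lc.
  have [->|cp] := pselect (c = p); first exact: Or31.
  have [->|cq] := pselect (c = q); first exact: Or32.
  by apply: Or33; split; apply: lob_clique ab _ _ _.
have Lx : lobe_through x y x by apply: Or31.
have Ly : lobe_through x y y by apply: Or32.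
apply/seteqP; split=> c Lc; first exact: mem xy Lz Lw Lc.
by apply: (mem z w) Lc => //; apply: (mem x y).
Qed.

Lemma lobe_colobal L z w : is_lobe L -> L z -> L w -> z <> w -> colobal z w.
Proof. by move=> [x [y [xy ->]]]; apply: lob_clique. Qed.

Lemma lobe_lob L z w : is_lobe L -> L z -> L w -> z <> w -> L = lobe_through z w.
Proof. by move=> [x [y [xy ->]]]; apply: lob_eq. Qed.

Lemma lobe_meet L M z w : is_lobe L -> is_lobe M -> z <> w ->
  L z -> L w -> M z -> M w -> L = M.
Proof.
move=> lL lM zw Lz Lw Mz Mw.
by rewrite (lobe_lob lL Lz Lw zw) (lobe_lob lM Mz Mw zw).
Qed.

Lemma lobe_ext L u v w : is_lobe L -> L u -> L v -> u <> v ->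
  colobal w u -> colobal w v -> L w.
Proof. by move=> lL Lu Lv uv wu wv; rewrite (lobe_lob lL Lu Lv uv); apply: Or33. Qed.

Lemma colobal_lobe x y : colobal x y ->
  [/\ is_lobe (lobe_through x y), lobe_through x y x & lobe_through x y y].
Proof. by move=> xy; split; [exists x, y|apply: Or31|apply: Or32]. Qed.

Lemma lobe_two L : is_lobe L -> exists x y, [/\ L x, L y & x <> y].
Proof.
move=> [x [y [[xy _] ->]]]; exists x, y; split=> //; [exact: Or31|exact: Or32].
Qed.

Lemma lobe_other L x : is_lobe L -> exists2 y, L y & y <> x.
Proof.
move=> /lobe_two[y [z [Ly Lz yz]]].
have [yx|yx] := pselect (y = x); last by exists y.
by exists z => // zx; apply: yz; rewrite zx.
Qed.

Lemma prj_id L u : L u -> prj L u u.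
Proof. by move=> Lu; split=> //; apply: conn_refl; left. Qed.

Lemma prj_in L w u : prj L w u -> L w -> w = u.
Proof. by move=> [_ wu] Lw; have [[->|/(_ Lw)] //] := conn_ends wu. Qed.

Lemma prj_exists L w : is_lobe L -> exists u, prj L w u.
Proof.
move=> lL; have [Lw|nLw] := pselect (L w); first by exists w; apply: prj_id.
have [x [_ [Lx _ _]]] := lobe_two lL.
have [u [v [wu Auv nnLv _]]] := conn_exit (Q := ~` L) (Aconn w x) nLw (fun h => h Lx).
have Lv : L v by apply: contrapT.
exists v; split=> //.
apply: (@conn_trans _ _ _ _ u).
  by apply: conn_sub wu => z [_ nLz]; right.
have [_ [_ nLu]] := conn_ends wu.
by apply: conn_edge => //; [right|left].
Qed.

(** A walk outside [L] joining two vertices of [L] would be an ear, whose first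
    vertex would belong to [L]. *)
Lemma prj_uniq L w u v : is_lobe L -> prj L w u -> prj L w v -> u = v.
Proof.
move=> lL pu pv; have [Lu wu] := pu; have [Lv wv] := pv.
have [Lw|nLw] := pselect (L w); first by rewrite -(prj_in pu Lw) (prj_in pv Lw).
apply: contrapT => uv.
have [a [b [wa Aab nnLb bu]]] := conn_exit (Q := ~` L) wu nLw (fun h => h Lu).
have [_ [_ nLa]] := conn_ends wa.
have eb : b = u by have [[->|nLb] _] := conn_ends bu; [|case: nnLb].
rewrite {b nnLb bu}eb in Aab.
have cau := adj_colobal Aab.
have au := adj_neq Aab.
apply: (nLa); apply: (lobe_ext lL Lu Lv uv cau); split=> [av|z za zv].
  by apply: nLa; rewrite av.
have [zu|zu] := pselect (z = u).
  rewrite zu; apply: (@off_trans _ _ w).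
    by apply/off_sym; apply: conn_sub wa => t [_ nLt] /= tu; apply: nLt; rewrite tu.
  apply: conn_sub wv => t /= [->|nLt] tu; first by apply: uv.
  by apply: nLt; rewrite tu.
apply: (@off_trans _ _ u); first by apply: off_edge => // /esym.
have [_] := lobe_colobal lL Lu Lv uv; exact.
Qed.

Lemma prj_edge L w w' u : is_lobe L -> A w w' -> prj L w u ->
  prj L w' u \/ (L w /\ L w').
Proof.
move=> lL Aww' pu; have [Lu wu] := pu.
have [Lw|nLw] := pselect (L w); have [Lw'|nLw'] := pselect (L w'); try tauto.
- left; split=> //; apply: conn_step wu; [by right|exact: Asym].
- left; suff pw' : prj L w w' by rewrite (prj_uniq lL pu pw'); apply: prj_id.
  by split=> //; apply: conn_edge => //; [right|left].
- left; split=> //; apply: conn_step wu; [by right|exact: Asym].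
Qed.

(** Only edges of [L] move the projection, so a walk projects to a walk in
    [L]. *)
Lemma prj_walk L (Z : set T) w w' u : is_lobe L -> conn A (~` Z) w w' ->
  prj L w u -> ~ Z u -> exists2 u', prj L w' u' & conn A (L `\` Z) u u'.
Proof.
move=> lL ww'; elim: ww' u => [v _ u pu nZu|v v1 v2 nZv Av v12 IH u pu nZu].
  by exists u => //; apply: conn_refl; split=> //; case: pu.
have [/IH/(_ nZu)//|[Lv Lv1]] := prj_edge lL Av pu.
have [nZv1 _] := conn_ends v12.
have [u' pu' vu'] := IH v1 (prj_id Lv1) nZv1.
exists u' => //; rewrite -(prj_in pu Lv).
exact: conn_step vu'.
Qed.

Lemma lobe_conn_off L z u v : is_lobe L -> L u -> L v -> u <> z -> v <> z ->
  conn A (L `\` [set z]) u v.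
Proof.
move=> lL Lu Lv uz vz; have [<-|uv] := pselect (u = v); first exact: conn_refl.
have [_ /(_ z (nesym uz) (nesym vz)) uzv] := lobe_colobal lL Lu Lv uv.
have [v' pv' uv'] := prj_walk lL uzv (prj_id Lu) uz.
by rewrite (prj_in pv' Lv).
Qed.

Lemma lobe_conn L u v : is_lobe L -> L u -> L v -> conn A L u v.
Proof.
move=> lL Lu Lv; have uv : conn A (~` set0) u v by rewrite setC0.
have [v' pv' uv'] := prj_walk lL uv (prj_id Lu) id.
by rewrite (prj_in pv' Lv); apply: conn_sub uv' => z [].
Qed.

Lemma lobe_neighbour L u : is_lobe L -> L u -> exists2 v, L v & A u v.
Proof.
move=> lL Lu; have [v Lv vu] := lobe_other u lL.
have [u' [v' [uu' Auv _ v'v]]] :=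
  conn_exit (Q := [set u]) (lobe_conn lL Lu Lv) erefl vu.
have [_ [_ eu]] := conn_ends uu'; have [Lv' _] := conn_ends v'v.
by exists v' => //; rewrite -eu.
Qed.

Lemma prj_lobe L M w w' u : is_lobe L -> is_lobe M -> L <> M ->
  M w -> M w' -> prj L w u -> prj L w' u.
Proof.
move=> lL lM LM Mw Mw'.
apply: (@conn_invariant _ A (fun v => prj L v u) M); last exact: lobe_conn.
move=> a b Ma Mb Aab pa; have [//|[La Lb]] := prj_edge lL Aab pa.
by case: LM; apply: (lobe_meet lL lM (adj_neq Aab)).
Qed.

Lemma branch_neighbour x y : y <> x -> exists2 a, A x a & off x a y.
Proof.
move=> yx.
have [a [b [ya Aab nnb _]]] :=
  conn_exit (Q := ~` [set x]) (Aconn y x) yx (fun h => h erefl).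
have eb : b = x by apply: contrapT.
exists a; first by rewrite -eb; apply: Asym.
by apply/off_sym; apply: conn_sub ya => z [].
Qed.

Section Image.
Variables g h : T -> T.
Hypotheses (gK : cancel g h) (hK : cancel h g).
Hypothesis Ag : forall x y, A (g x) (g y) <-> A x y.

Let g_neq x y : x <> y -> g x <> g y.
Proof. by move=> xy /(can_inj gK). Qed.

Lemma off_image x y z : off x y z -> off (g x) (g y) (g z).
Proof.
apply: conn_map => [u ux|u v ux vx Auv]; first exact: g_neq.
by apply: conn_edge; [exact: g_neq|exact: g_neq|apply/Ag].
Qed.

Lemma colobal_image x y : colobal x y -> colobal (g x) (g y).
Proof.
move=> [xy h0]; split=> [|z zx zy]; first exact: g_neq.
rewrite -(hK z); apply/off_image/h0 => e; [apply: zx|apply: zy];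
by rewrite -e hK.
Qed.

End Image.

Lemma is_lobe_image g L : automorphism A g -> is_lobe L -> is_lobe (g @` L).
Proof.
move=> [h [gK hK Ag]] [x [y [xy ->]]].
have Ah u v : A (h u) (h v) <-> A u v by rewrite -Ag !hK.
have gxy := colobal_image gK hK Ag xy.
exists (g x), (g y); split=> //; apply/seteqP; split=> [_ [z Lz <-]|z Lz].
  case: Lz => [->|->|[zx zy]]; [exact: Or31|exact: Or32|apply: Or33].
  by split; apply: (colobal_image gK hK Ag).
exists (h z); last exact: hK.
case: Lz => [->|->|[zx zy]]; rewrite ?gK; [exact: Or31|exact: Or32|apply: Or33].
by rewrite -(gK x) -(gK y); split; apply: (colobal_image hK gK Ah).
Qed.

End Lobes.

(** * Orbital graphs of a primitive group *)

(** The underlying undirected graph of the orbital digraph of [(a, b)]. *)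
Definition orbital (T : Type) (G : set (T -> T)) (a b x y : T) : Prop :=
  exists2 g, G g & (x = g a /\ y = g b) \/ (x = g b /\ y = g a).

Section Group.
Variables (T : Type) (G : set (T -> T)).
Hypothesis G_group : permutation_group G.

Lemma group_inv g : G g -> exists h, [/\ G h, cancel g h & cancel h g].
Proof.
case: G_group => Gbij _ _ Ginv Gg; have [h gK hK] := Gbij g Gg.
by exists h; split=> //; apply: Ginv gK hK.
Qed.

Lemma group_id : G id. Proof. by case: G_group. Qed.

Lemma group_comp g h : G g -> G h -> G (fun x => g (h x)).
Proof. by case: G_group => _ _ Gcomp _; apply: Gcomp. Qed.

Lemma set_stabiliser_inv L g : set_stabiliser G L g ->
  exists h, [/\ set_stabiliser G L h, cancel g h & cancel h g].
Proof.
move=> [Gg gL]; have [h [Gh gK hK]] := group_inv Gg.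
exists h; split=> //; split=> //; apply/seteqP.
split=> [_ [x + <-]|x Lx]; first by rewrite -{1}gL => -[y Ly <-]; rewrite gK.
by exists (g x); [rewrite -gL; exists x|rewrite gK].
Qed.

Lemma set_stabiliser_comp L g h : set_stabiliser G L g ->
  set_stabiliser G L h -> set_stabiliser G L (fun x => g (h x)).
Proof.
move=> [Gg gL] [Gh hL]; split; first exact: group_comp.
by rewrite -[RHS]gL -[in RHS]hL image_comp.
Qed.

Lemma set_stabiliser_mem L g x : set_stabiliser G L g -> L x -> L (g x).
Proof. by move=> [_ gL] Lx; rewrite -gL; exists x. Qed.

Lemma set_stabiliser_group L : permutation_group (set_stabiliser G L).
Proof.
split.
- by move=> g [Gg _]; case: G_group => Gbij _ _ _; apply: Gbij.
- by split; [exact: group_id|rewrite image_id].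
- by move=> g h Gg Gh; apply: set_stabiliser_comp.
- move=> g h Gg gK hK; have [h' [Gh' gK' hK']] := set_stabiliser_inv Gg.
  suff -> : h = h' by [].
  by apply/funext => x; rewrite -{1}(hK' x) gK.
Qed.

End Group.

Section Orbital.
Variables (T : Type) (G : set (T -> T)).
Hypothesis G_group : permutation_group G.
Hypothesis G_primitive : primitive_on G [set: T].
Variables a b : T.
Hypothesis ab : a <> b.

Let A := orbital G a b.
Implicit Types (L M : set T) (u v w x y z : T).

Lemma orbital_sym x y : A x y -> A y x.
Proof. by move=> [g Gg h]; exists g => //; tauto. Qed.

Lemma orbital_irr x : ~ A x x.
Proof.
move=> [g Gg]; have [h [_ gK _]] := group_inv G_group Gg.
by case=> -[-> /(can_inj gK) e]; apply: ab; rewrite e.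
Qed.

Lemma orbital_automorphism g : G g -> automorphism A g.
Proof.
move=> Gg; have [h [Gh gK hK]] := group_inv G_group Gg.
exists h; split=> // x y; split=> -[k Gk e].
  exists (fun t => h (k t)); first exact: (group_comp G_group).
  by case: e => -[<- <-]; [left|right]; rewrite !gK.
exists (fun t => g (k t)); first exact: (group_comp G_group).
by case: e => -[-> ->]; [left|right].
Qed.

Lemma orbital_conn x y : conn A setT x y.
Proof.
have [_ prim] := G_primitive.
have [|g u v Gg _ _|triv|univ] := prim (conn A setT).
- split=> [u _|u v _ _|u v w _ _ _]; first exact: conn_refl.
    exact: conn_sym orbital_sym.
  exact: conn_trans.
- apply: conn_map => // s t _ _ st; apply: conn_edge => //.
  by have [h [_ _ ->]] := orbital_automorphism Gg.
- case: ab; apply: triv => //; apply: conn_edge => //.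
  by exists id; [exact: (group_id G_group)|left].
- exact: univ.
Qed.

Lemma lobe_image g L : G g -> is_lobe A L -> is_lobe A (g @` L).
Proof.
by move=> Gg; apply: is_lobe_image; apply: orbital_automorphism.
Qed.

Lemma off_orbital_image g x y z : G g -> off A x y z -> off A (g x) (g y) (g z).
Proof.
move=> Gg; have [h [gK hK Ag]] := orbital_automorphism Gg.
exact: (off_image gK Ag).
Qed.

Lemma lobe_arc L : is_lobe A L -> exists g, [/\ G g, L (g a) & L (g b)].
Proof.
move=> lL; have [x [_ [Lx _ _]]] := lobe_two lL.
have [y Ly [g Gg e]] :=
  lobe_neighbour orbital_sym orbital_irr orbital_conn lL Lx.
by exists g; case: e => -[<- <-].
Qed.

Lemma lobe_eq_meet L M z w : is_lobe A L -> is_lobe A M -> z <> w ->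
  L z -> L w -> M z -> M w -> L = M.
Proof. exact: (lobe_meet orbital_sym). Qed.

Lemma lobe_transitive L M : is_lobe A L -> is_lobe A M ->
  exists2 g, G g & g @` L = M.
Proof.
move=> lL lM; have [g [Gg La Lb]] := lobe_arc lL; have [k [Gk Ma Mb]] := lobe_arc lM.
have [h [Gh gK hK]] := group_inv G_group Gg; have [k' [_ kK _]] := group_inv G_group Gk.
exists (fun x => k (h x)); first exact: (group_comp G_group).
apply: (@lobe_eq_meet _ _ (k a) (k b)) => //.
- by apply: lobe_image => //; apply: (group_comp G_group).
- by move=> /(can_inj kK).
- by exists (g a) => //; rewrite gK.
- by exists (g b) => //; rewrite gK.
Qed.

(** The equivalence relation generated by the translates of an invariant
    relation [R] on a lobe [L] is invariant under [G]. On [L] it is not coarser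
    than [R], as all translates of [R] living on other lobes are collapsed by
    the projection onto [L]. *)
Lemma lobe_relation L (R : T -> T -> Prop) : is_lobe A L ->
    equivalence_on L R -> invariant_on (set_stabiliser G L) L R ->
  (forall x y, L x -> L y -> R x y -> x = y) \/
  (forall x y, L x -> L y -> R x y).
Proof.
move=> lL [Rrefl Rsym Rtrans] Rinv.
pose B w w' := exists g x y, [/\ G g, L x, L y, R x y & w = g x /\ w' = g y].
have Bsym w w' : B w w' -> B w' w.
  move=> [g [x [y [Gg Lx Ly Rxy [-> ->]]]]]; exists g, y, x; split=> //.
  exact: Rsym.
have [_ prim] := G_primitive.
have [|g u v Gg _ _|triv|univ] := prim (conn B setT).
- split=> [u _|u v _ _|u v w _ _ _]; first exact: conn_refl.
    exact: conn_sym Bsym.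
  exact: conn_trans.
- apply: conn_map => // s t _ _ [h [x [y [Gh Lx Ly Rxy [-> ->]]]]].
  apply: conn_edge => //; exists (fun x => g (h x)), x, y; split=> //.
  exact: (group_comp G_group).
- left=> x y Lx Ly Rxy; apply: triv => //; apply: conn_edge => //.
  by exists id, x, y; split=> //; apply: (group_id G_group).
- right=> x y Lx Ly.
  suff [u pu Rxu] : exists2 u, prj A L y u & R x u by rewrite (prj_in pu Ly).
  have Qx : exists2 u, prj A L x u & R x u.
    by exists x; [exact: prj_id|exact: Rrefl].
  apply: (@conn_invariant _ B (fun w => exists2 u, prj A L w u & R x u)
    setT x y _ (univ x y I I) Qx) => w w' _ _.
  move=> [g [s [t [Gg Ls Lt Rst [-> ->]]]]] [u pu Rxu].
  have Lu : L u by case: pu.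
  have [gL|gL] := pselect (L = g @` L); last first.
    exists u => //; apply: (prj_lobe orbital_sym orbital_irr orbital_conn lL
      (lobe_image Gg lL) gL) pu; [by exists s|by exists t].
  have sg : set_stabiliser G L g by [].
  have Lgs := set_stabiliser_mem sg Ls; have Lgt := set_stabiliser_mem sg Lt.
  exists (g t); first exact: prj_id.
  apply: (Rtrans _ u) => //; rewrite -(prj_in pu Lgs).
  exact: Rinv.
Qed.

Definition cut_point x : Prop := exists y z, [/\ y <> x, z <> x & ~ off A x y z].

Lemma cut_point_lobes x : cut_point x ->
  exists L M, [/\ is_lobe A L, is_lobe A M, L x, M x & L <> M].
Proof.
move=> [y [z [yx zx nyz]]].
have [y1 Ay1 y1y] := branch_neighbour orbital_sym orbital_conn yx.
have [z1 Az1 z1z] := branch_neighbour orbital_sym orbital_conn zx.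
have [lL Lx Ly1] := colobal_lobe (adj_colobal orbital_irr Ay1).
have [lM Mx Mz1] := colobal_lobe (adj_colobal orbital_irr Az1).
exists (lobe_through A x y1), (lobe_through A x z1); split=> // LM; apply: nyz.
have y1z1 : conn A (lobe_through A x y1 `\` [set x]) y1 z1.
  apply: (lobe_conn_off orbital_sym orbital_irr) => //.
  - by rewrite LM.
  - by have [] := conn_ends y1y.
  - by have [] := conn_ends z1z.
apply: off_trans z1z; apply: off_trans (off_sym orbital_sym y1y) _.
by apply: conn_sub y1z1 => t [].
Qed.

Section Fold.
Variables (L : set T) (N : set (T -> T)).
Hypothesis lL : is_lobe A L.
Hypothesis N_group : permutation_group N.
Hypothesis N_mem : forall n x, N n -> L x -> L (n x).
Hypothesis N_sub : set_stabiliser G L `<=` N.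
Hypothesis N_regular : regular_on N L.

(** A map collapsing the graph onto the lobe [L], and restricting on every lobe
    to the action of a group element followed by an element of [N]. *)
Definition folding (f : T -> T) : Prop := forall M, is_lobe A M ->
  exists g n, [/\ G g, N n, g @` M = L & forall x, M x -> f x = n (g x)].

(** Two foldings of one lobe differ by an element of the regular group [N], which
    is determined by its value at one point. *)
Lemma folding_rigid M g n g' n' x y : G g -> N n -> g @` M = L ->
    G g' -> N n' -> g' @` M = L -> M x -> M y ->
  n (g x) = n' (g' x) -> n (g y) = n' (g' y).
Proof.
move=> Gg Nn gM Gg' Nn' gM' Mx My e.
have [h [Gh gK hK]] := group_inv G_group Gg.
have [m [Nm nK mK]] := group_inv N_group Nn.
have Lgx : L (g x) by rewrite -gM; exists x.
have Lgy : L (g y) by rewrite -gM; exists y.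
have Nk : N (fun t => g' (h t)).
  apply: N_sub; split; first exact: (group_comp G_group).
  rewrite -{1}gM -gM' image_comp; apply/seteqP.
  by split=> _ [t Mt <-]; exists t => //=; rewrite gK.
have Nt : N (fun t => m (n' (g' (h t)))).
  apply: (@group_comp _ N N_group m) => //.
  exact: (@group_comp _ N N_group n').
have [_ fix1] := N_regular.
have e1 : m (n' (g' (h (g x)))) = g x by rewrite gK -e nK.
have e2 : m (n' (g' (h (g y)))) = g y by apply: (fix1 _ _ Lgx Nt e1 _ Lgy).
by rewrite -e2 mK gK.
Qed.

Lemma folding_unique f f' x : folding f -> folding f' -> f x = f' x ->
  forall y, f y = f' y.
Proof.
move=> Ff Ff' e y.
apply: (@conn_invariant _ A (fun y => f y = f' y) setT x y) => //; last first.
  exact: orbital_conn.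
move=> u v _ _ Auv euv.
have [lM Mu Mv] := colobal_lobe (adj_colobal orbital_irr Auv).
have [g [n [Gg Nn gM fM]]] := Ff _ lM; have [g' [n' [Gg' Nn' gM' fM']]] := Ff' _ lM.
rewrite fM // fM' //.
have e2 : n (g u) = n' (g' u) by rewrite -fM // -fM'.
exact: (folding_rigid Gg Nn gM Gg' Nn' gM' Mu Mv e2).
Qed.

(** Preceding [f] by an element of [G] gives a folding again, and by uniqueness
    this is [f] followed by an element of [N]; hence the fibres of [f] are the
    classes of a [G]-invariant relation.  It separates the points of one lobe,
    but not those of two lobes that meet. *)
Lemma folding_no_cut_point f x : folding f -> ~ cut_point x.
Proof.
move=> Ff /cut_point_lobes[M1 [M2 [lM1 lM2 M1x M2x M12]]].
have Lf y : L (f y).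
  have [tr _] := G_primitive; have [c Gc cay] := tr a y I I.
  have Ayy' : A y (c b) by exists c => //; left.
  have [lM My My'] := colobal_lobe (adj_colobal orbital_irr Ayy').
  have [g [n [Gg Nn gM fM]]] := Ff _ lM.
  by rewrite fM //; apply: N_mem => //; rewrite -gM; exists y.
have [_ prim] := G_primitive.
have [//|k y z Gk _ _ fyz|triv|univ] := prim (fun x y => f x = f y).
- by split=> // ? ? ? _ _ _ -> ->.
- have [tr _] := N_regular; have [h Nh hfy] := tr _ _ (Lf y) (Lf (k y)).
  have F1 : folding (fun t => f (k t)).
    move=> M lM; have [g [n [Gg Nn gM fM]]] := Ff _ (lobe_image Gk lM).
    exists (fun t => g (k t)), n; split=> //; first exact: (group_comp G_group).
      by rewrite -gM image_comp.
    by move=> t Mt; apply: fM; exists t.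
  have F2 : folding (fun t => h (f t)).
    move=> M lM; have [g [n [Gg Nn gM fM]]] := Ff _ lM.
    exists g, (fun t => h (n t)); split=> //; first exact: (group_comp N_group).
    by move=> t Mt; rewrite fM.
  have e := folding_unique F2 F1 hfy.
  by rewrite -!e fyz.
- have [z1 M1z1 z1x] := lobe_other x lM1.
  have [g [n [Gg Nn gM fM]]] := Ff _ lM2.
  have [m [Nm nK mK]] := group_inv N_group Nn.
  have : L (m (f z1)) by apply: N_mem.
  rewrite -gM => -[z2 M2z2 gz2].
  have e : z1 = z2 by apply: triv => //; rewrite (fM z2 M2z2) gz2 mK.
  apply: M12; apply: (lobe_eq_meet (z := x) (w := z1)) => //.
    exact: nesym.
  by rewrite e.
- have [u [v [Lu Lv uv]]] := lobe_two lL.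
  have [g [n [Gg Nn gM fM]]] := Ff _ lL.
  have [m [Nm nK mK]] := group_inv N_group Nn.
  have [h [Gh gK hK]] := group_inv G_group Gg.
  apply: uv; apply: (can_inj gK); apply: (can_inj nK).
  by rewrite -!fM //; apply: univ.
Qed.

Variable x0 : T.
Hypothesis Lx0 : L x0.

(** The graph of the folding fixing [x0].  The value at [x] is determined by the
    value at the parent [u] of [x], which is the projection of [x0] to the first
    lobe on the way from [x] to [x0]. *)
Inductive fold_at : T -> T -> Prop :=
| fold_base : fold_at x0 x0
| fold_step M u x g n : is_lobe A M -> M x -> prj A M x0 u -> x <> u ->
    G g -> N n -> g @` M = L -> fold_at u (n (g u)) -> fold_at x (n (g x)).

Lemma fold_inv x c : fold_at x c -> (x = x0 /\ c = x0) \/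
  exists M u g n, [/\ is_lobe A M, M x, prj A M x0 u & x <> u] /\
    [/\ G g, N n, g @` M = L, fold_at u (n (g u)) & c = n (g x)].
Proof.
case=> [|M u y g n lM My pu yu Gg Nn gM fu]; first by left.
by right; exists M, u, g, n.
Qed.

Lemma parent_base M u : M x0 -> prj A M x0 u -> u = x0.
Proof. by move=> Mx0 pu; rewrite (prj_in pu Mx0). Qed.

(** If two lobes through [x] led towards [x0], then deleting [x] would not
    separate them; but the projection onto one maps the other to [x]. *)
Lemma parent_uniq M u M' u' x : is_lobe A M -> M x -> prj A M x0 u -> x <> u ->
    is_lobe A M' -> M' x -> prj A M' x0 u' -> x <> u' ->
  M = M' /\ u = u'.
Proof.
move=> lM Mx pu xu lM' Mx' pu' xu'.
have Asym := orbital_sym; have Airr := orbital_irr; have Aconn := orbital_conn.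
have toward P v : P x -> prj A P x0 v -> x <> v -> off A x x0 v.
  move=> Px [_ x0v] xv; apply: conn_sub x0v => z [->|nPz]; first exact: nesym.
  by move=> zx; apply: nPz; rewrite zx.
have [eM|MM'] := pselect (M = M').
  by split=> //; subst M'; apply: (prj_uniq Asym Airr lM pu pu').
have [Mu _] := pu; have [Mu' _] := pu'.
have pu'x : prj A M u' x.
  exact: (prj_lobe Asym Airr Aconn lM lM' MM' Mx' Mu' (prj_id A Mx)).
have uu' : off A x u u'.
  apply: off_trans (toward _ _ Mx' pu' xu').
  exact/(off_sym Asym)/(toward _ _ Mx pu xu).
have [u'' pu'' uu''] := prj_walk Asym Airr lM uu' (prj_id A Mu) (nesym xu).
have [_ [_ []]] := conn_ends uu''.
exact: (prj_uniq Asym Airr lM pu'' pu'x).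
Qed.

Lemma fold_uniq x c c' : fold_at x c -> fold_at x c' -> c = c'.
Proof.
move=> xc; elim: xc c' => [|M u y g n lM My pu yu Gg Nn gM _ IH] c'.
  move=> /fold_inv[[]//|[M [u [g [n [[lM Mx pu xu] _]]]]]].
  by case: xu; rewrite (parent_base Mx pu).
move=> /fold_inv[[yx0 _]|[M' [u' [g' [n' [[lM' My' pu' yu']]]]]]].
  by case: yu; rewrite yx0 in My *; rewrite (parent_base My pu).
move=> [Gg' Nn' gM' fu' ->].
have [eM eu] := parent_uniq lM My pu yu lM' My' pu' yu'; subst M' u'.
have [Mu _] := pu.
exact: (folding_rigid Gg Nn gM Gg' Nn' gM' Mu My (IH _ fu')).
Qed.

Lemma fold_mem x c : fold_at x c -> L c.
Proof.
case=> // M u y g n lM My _ _ Gg Nn gM _.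
by apply: N_mem => //; rewrite -gM; exists y.
Qed.

Lemma fold_parent M u x c : is_lobe A M -> M x -> prj A M x0 u -> fold_at x c ->
  exists c', fold_at u c'.
Proof.
move=> lM Mx pu xc.
have [->|xu] := pselect (u = x); first by exists c.
case/fold_inv: (xc) => [[xx0 _]|[M' [u' [g [n [[lM' Mx' pu' xu']]]]]]].
  by case: xu; rewrite xx0 in Mx *; rewrite (parent_base Mx pu).
move=> [Gg Nn gM fu _].
have [_ ->] := parent_uniq lM Mx pu (nesym xu) lM' Mx' pu' xu'.
by exists (n (g u')).
Qed.

Lemma fold_lobe M u c : is_lobe A M -> prj A M x0 u -> fold_at u c ->
  exists g n, [/\ G g, N n, g @` M = L & forall x, M x -> fold_at x (n (g x))].
Proof.
move=> lM pu uc; have [Mu _] := pu.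
have [g Gg gM] := lobe_transitive lM lL.
have Lgu : L (g u) by rewrite -gM; exists u.
have [tr _] := N_regular.
have [n Nn ngu] := tr _ _ Lgu (fold_mem uc).
exists g, n; split=> // x Mx.
have [->|xu] := pselect (x = u); first by rewrite ngu.
by apply: (fold_step lM Mx pu xu Gg Nn gM); rewrite ngu.
Qed.

Lemma fold_total x : exists c, fold_at x c.
Proof.
have Asym := orbital_sym; have Airr := orbital_irr; have Aconn := orbital_conn.
apply: (@conn_invariant _ A (fun x => exists c, fold_at x c) setT x0 x) => //;
  last by exists x0; exact: fold_base.
move=> y z _ _ Ayz [c yc].
have [lM My Mz] := colobal_lobe (adj_colobal Airr Ayz).
have [u pu] := prj_exists Aconn x0 lM.
have [c' uc'] := fold_parent lM My pu yc.
have [g [n [_ _ _ h]]] := fold_lobe lM pu uc'.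
by exists (n (g z)); apply: h.
Qed.

Lemma folding_exists : exists f, folding f.
Proof.
have [f fP] := choice fold_total.
exists f => M lM; have [u pu] := prj_exists orbital_conn x0 lM.
have [g [n [Gg Nn gM h]]] := fold_lobe lM pu (fP u).
exists g, n; split=> // x Mx; apply: fold_uniq (fP x) _; exact: h.
Qed.

End Fold.

(** No stabiliser of a lobe is contained in a regular group, for else all lobes
    could be folded onto one, and the fibres of the folding would be blocks of
    imprimitivity. *)
Lemma lobe_not_regular L N x : is_lobe A L -> permutation_group N ->
    (forall n y, N n -> L y -> L (n y)) -> set_stabiliser G L `<=` N ->
  cut_point x -> ~ regular_on N L.
Proof.
move=> lL N_group N_mem N_sub cx N_regular.
have [x0 [_ [Lx0 _ _]]] := lobe_two lL.
have [f Ff] := folding_exists lL N_group N_mem N_sub N_regular Lx0.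
exact: (folding_no_cut_point lL N_group N_mem N_sub N_regular Ff cx).
Qed.

End Orbital.

Lemma bijections_group (T : Type) : permutation_group [set g : T -> T | bijective g].
Proof.
split=> // [|g h|g h _ gK hK]; first by exists id.
  exact: bij_comp.
by exists g.
Qed.

(** * Stabilisers of lobes *)

Section CutPoint.
Variables (T : Type) (G : set (T -> T)).
Hypothesis G_group : permutation_group G.
Hypothesis G_primitive : primitive_on G [set: T].
Variables a b : T.
Hypothesis ab : a <> b.

Let A := orbital G a b.
Let Asym := @orbital_sym T G a b.
Let Airr := orbital_irr G_group ab.
Let Aconn := orbital_conn G_group G_primitive ab.
Implicit Types (L M : set T) (u v w x y z : T).

Variable p : T.
Hypothesis p_cut : cut_point G a b p.

(** The group of all bijections is regular on a set with two elements, and a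
    lobe stabiliser is not contained in a regular group. *)
Lemma lobe_three L : is_lobe A L ->
  exists x y z, [/\ L x, L y & L z] /\ [/\ x <> y, x <> z & y <> z].
Proof.
move=> lL; have [x [y [Lx Ly xy]]] := lobe_two lL.
apply: contrapT => no3.
have Lxy z : L z -> z = x \/ z = y.
  move=> Lz; apply: contrapT => nz; apply: no3.
  by exists x, y, z; split; split=> // e; apply: nz; rewrite e; tauto.
pose B := [set g : T -> T | bijective g].
have B_group := bijections_group T.
apply: (lobe_not_regular G_group G_primitive ab lL
  (set_stabiliser_group B_group L) _ _ p_cut).
- by move=> n z Bn Lz; apply: set_stabiliser_mem Bn Lz.
- by move=> g [Gg gL]; split=> //; case: G_group => Gbij _ _ _; apply: Gbij.
pose s t := if `[< t = x >] then y else if `[< t = y >] then x else t.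
have sx : s x = y by rewrite /s; case: asboolP.
have sy : s y = x.
  by rewrite /s; case: asboolP => [/esym//|_]; case: asboolP.
have ss : cancel s s.
  move=> t; have [->|tx] := pselect (t = x); first by rewrite sx sy.
  have [->|ty] := pselect (t = y); first by rewrite sy sx.
  have st : s t = t by rewrite /s; case: asboolP => // _; case: asboolP.
  by rewrite !st.
have sB : set_stabiliser B L s.
  split; first by exists s.
  apply/seteqP; split=> [_ [t /Lxy[]-> <-]|t /Lxy[]->]; rewrite ?sx ?sy //.
    by exists y.
  by exists x.
split=> [u v|u g Lu [[h gK hK] gL] gu v Lv].
  have idB : set_stabiliser B L id by split; [exists id|rewrite image_id].
  by move=> /Lxy[]-> /Lxy[]->; [exists id|exists s|exists s|exists id].
have Lgv : L (g v) by rewrite -gL; exists v.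
have [->//|vu] := pselect (v = u).
have gvu : g v <> u by move=> e; apply: vu; apply: (can_inj gK); rewrite gu.
by case: (Lxy _ Lu) => eu; case: (Lxy _ Lv) => ev; case: (Lxy _ Lgv) => egv;
  congruence.
Qed.

(** Being in one orbit is an invariant relation on the lobe.  If it is trivial,
    then the lobe is fixed pointwise and every relation is invariant, which is
    absurd for a set with three elements. *)
Lemma lobe_stabiliser_transitive L : is_lobe A L ->
  transitive_on (set_stabiliser G L) L.
Proof.
move=> lL.
have [||triv|//] := lobe_relation G_group G_primitive ab
  (R := fun x y => exists2 g, set_stabiliser G L g & g x = y) lL.
- split=> [x Lx|x y Lx Ly [g Gg <-]|x y z Lx Ly Lz [g Gg <-] [h Gh <-]].
  + exists id => //; split; [exact: group_id|exact: image_id].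
  + have [h [Gh gK hK]] := set_stabiliser_inv G_group Gg.
    by exists h.
  + by exists (fun t => h (g t)) => //; apply: set_stabiliser_comp.
- move=> k x y Gk Lx Ly [g Gg <-].
  have [h [Gh kK hK]] := set_stabiliser_inv G_group Gk.
  exists (fun t => k (g (h t))); last by rewrite kK.
  apply: set_stabiliser_comp => //.
  exact: (@set_stabiliser_comp _ _ G_group L g h).
have [x [y [z [[Lx Ly Lz] [xy xz yz]]]]] := lobe_three lL.
pose R s t := s = t \/ (s <> z /\ t <> z).
have [||triv'|univ] := lobe_relation G_group G_primitive ab (R := R) lL.
- split=> [u _|u v _ _ [->|[? ?]]|u v w _ _ _ [->//|[uz vz]]].
  + by left.
  + by left.
  + by right.
  + by move=> [<-|[_ wz]]; right.
- move=> g u v Gg Lu Lv Ruv.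
  have fixg t : L t -> g t = t.
    by move=> Lt; apply/esym/triv => //; [exact: set_stabiliser_mem Gg _|exists g].
  by rewrite !fixg.
- by case: xy; apply: triv' => //; right.
- by case: (univ x z Lx Lz) => // -[_ /(_ erefl)].
Qed.

Lemma lobe_stabiliser_primitive L : is_lobe A L ->
  primitive_on (set_stabiliser G L) L.
Proof.
move=> lL; split; first exact: lobe_stabiliser_transitive.
by move=> R eR iR; apply: (lobe_relation G_group G_primitive ab lL).
Qed.

Lemma lobe_stabiliser_not_regular L : is_lobe A L ->
  ~ regular_on (set_stabiliser G L) L.
Proof.
move=> lL; apply: (lobe_not_regular G_group G_primitive ab lL _ _ _ p_cut) => //.
  exact: set_stabiliser_group.
by move=> n y Gn Ly; apply: set_stabiliser_mem Gn Ly.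
Qed.

(** If the neighbour of [x] found in the branch is an in-neighbour, then an
    element of the lobe stabiliser mapping it to [x] gives an out-neighbour in
    the same lobe. *)
Lemma branch_out x y : y <> x ->
  exists g, [/\ G g, x = g a & off A x (g b) y].
Proof.
move=> yx; have [z Axz zy] := branch_neighbour Asym Aconn yx.
have [g Gg [[xa zb]|[xb za]]] := Axz; first by exists g; split=> //; rewrite -zb.
have [lL Lx Lz] := colobal_lobe (adj_colobal Airr Axz).
have [s Ls sz] := lobe_stabiliser_transitive lL Lz Lx.
have [Gs _] := Ls; have Lsx := set_stabiliser_mem Ls Lx.
exists (fun t => s (g t)); split.
- exact: (group_comp G_group).
- by rewrite -za sz.
rewrite -xb; apply: off_trans zy.
have xz : x <> z := adj_neq Airr Axz.
have sxx : s x <> x.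
  move=> e; apply: xz; have [h [_ sK _]] := group_inv G_group Gs.
  by apply: (can_inj sK); rewrite sz.
have := lobe_conn_off Asym Airr lL Lsx Lz sxx (nesym xz).
by apply: conn_sub => t [].
Qed.

Lemma branches_transitive x y z : y <> x -> z <> x ->
  exists2 g, point_stabiliser G x g & off A x (g y) z.
Proof.
move=> /branch_out[g [Gg xg gy]] /branch_out[h [Gh xh hz]].
have [g' [Gg' gK g'K]] := group_inv G_group Gg.
have kx : h (g' x) = x by rewrite {1}xg gK.
have Gk : G (fun t => h (g' t)) by apply: (group_comp G_group).
exists (fun t => h (g' t)); first by split.
apply: off_trans hz.
have := off_orbital_image (b := b) G_group (a := a) Gk (off_sym Asym gy).
by rewrite /= kx gK.
Qed.

End CutPoint.

(** * Numbers of branches *)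

Lemma card_ge_II (T : Type) (X : set T) k (e : nat -> T) :
    (forall i, i < k -> X (e i)) ->
    (forall i j, i < k -> j < k -> e i = e j -> i = j) ->
  `I_k #<= X.
Proof.
move=> eX einj.
have inj : {in `I_k &, injective e} by move=> i j /set_mem ik /set_mem jk; apply: einj.
rewrite -(card_le_eql (inj_card_eq inj)); apply: subset_card_le.
by move=> _ [i ik <-]; apply: eX.
Qed.

(** Only the values of [f] below [k] matter. *)
Definition branches (T : Type) (A : T -> T -> Prop) (k : nat) (x : T)
    (f : nat -> T) : Prop :=
  (forall i, i < k -> f i <> x) /\
  (forall i j, i < k -> j < k -> off A x (f i) (f j) -> i = j).

Section Branches.
Variables (T : Type) (G : set (T -> T)).
Hypothesis G_group : permutation_group G.
Hypothesis G_primitive : primitive_on G [set: T].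

Lemma branches_cut_point a b k x f : 1 < k ->
  branches (orbital G a b) k x f -> cut_point G a b x.
Proof.
move=> k1 [fx finj]; exists (f 0), (f 1); split; [exact/fx/ltnW|exact: fx|].
by move=> /(finj 0 1 (ltnW k1) k1).
Qed.

Lemma branches_move a b k x x' f : branches (orbital G a b) k x f ->
  exists f', branches (orbital G a b) k x' f'.
Proof.
move=> [fx finj]; have [tr _] := G_primitive.
have [g Gg gx] := tr x x' I I.
have [h [Gh gK hK]] := group_inv G_group Gg.
exists (fun i => g (f i)); split=> [i ik|i j ik jk].
  by rewrite -gx => /(can_inj gK); apply: fx.
move=> /(off_orbital_image G_group Gh); rewrite !gK -gx gK; exact: finj.
Qed.

(** The stabiliser of [x] permutes the branches at [x] transitively, so that
    each of them meets the suborbit of [y].  (The successor accounts for the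
    case of a single branch.) *)
Lemma branches_bound a b k x f y : a <> b -> y <> x ->
    finite_set (Defs.orbit (point_stabiliser G x) y) ->
    branches (orbital G a b) k x f ->
  k <= (ncard (Defs.orbit (point_stabiliser G x) y)).+1.
Proof.
move=> ab yx fin Hf; have [k1|k1] := leqP k 1; first exact: leq_trans k1 _.
have cx := branches_cut_point k1 Hf; have [fx finj] := Hf.
have Asym := @orbital_sym T G a b.
have : forall i, exists z, i < k ->
    Defs.orbit (point_stabiliser G x) y z /\ off (orbital G a b) x z (f i).
  move=> i; have [ik|_] := boolP (i < k); last by exists x.
  have [g Gg gy] := branches_transitive G_group G_primitive ab cx yx (fx i ik).
  by exists (g y) => _; split=> //; exists g.
move=> /choice[e eP]; apply: leqW.
apply: (@leq_card_fset_set {classic T}) => //.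
apply: (@card_ge_II _ _ k e) => [i ik|i j ik jk eij]; first by case: (eP i ik).
apply: finj => //; have [_ h1] := eP i ik; have [_ h2] := eP j jk.
by rewrite eij in h1; apply: off_trans h2; apply: (off_sym Asym).
Qed.

End Branches.

(** * Refining an orbital graph along a lobe with a cut *)

(** The group acts on the lobe [L] as on a graph of its own.  A pair given by
    [cut_pair] spans an orbital graph of the whole group none of whose edges
    away from [x] crosses the preimage of a certain cut under the projection
    onto [L]; so [L] minus [x] falls apart. *)
Lemma refine_lobe (T : Type) (G : set (T -> T)) (a b : T) (L K : set T) :
    permutation_group G -> primitive_on G [set: T] -> a <> b ->
    is_lobe (orbital G a b) L ->
    K `<=` L -> infinite_set K -> infinite_set (L `\` K) ->
    finite_set [set e | orbital G a b e.1 e.2 /\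
                        [/\ L e.1, L e.2 & ~ (K e.1 <-> K e.2)]] ->
  exists a' b' x y z, a' <> b' /\ [/\ L x, L y, L z, y <> x & z <> x] /\
    ~ off (orbital G a' b') x y z /\
    forall u v, off (orbital G a' b') x u v -> off (orbital G a b) x u v.
Proof.
move=> G_group G_primitive ab lL KL iK iK' fK.
set A := orbital G a b in lL fK *.
have Asym := @orbital_sym T G a b.
have Airr := orbital_irr G_group ab.
have Aconn := orbital_conn G_group G_primitive ab.
pose E (s t : {x | L x}) := A (sval s) (sval t).
pose C : set {x | L x} := [set s | K (sval s)].
have Esym s t : E s t -> E t s by apply: Asym.
have sval_inj : injective (fun s : {x | L x} => sval s).
  by move=> [s ps] [t pt] /= est; apply: eq_exist.
have Econn s t : conn E setT s t.
  have lift u v : conn A L u v ->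
      forall pu pv, conn E setT (exist _ u pu) (exist _ v pv).
    elim=> [w Lw pu pv|w w1 w2 Lw Aw w12 IH pu pv].
      by rewrite (Prop_irrelevance pu pv); apply: conn_refl.
    have [Lw1 _] := conn_ends w12.
    by apply: (@conn_step _ _ _ _ (exist _ w1 Lw1)) => //; apply: IH.
  case: s t => [u pu] [v pv]; apply: lift; exact: (lobe_conn Asym Airr Aconn lL).
have cutC : infinite_cut E C.
  split.
  - move=> fC; apply: iK; apply: sub_finite_set (finite_image sval fC) => u Ku.
    by exists (exist _ u (KL u Ku)).
  - move=> fC; apply: iK'; apply: sub_finite_set (finite_image sval fC) => u [Lu nKu].
    by exists (exist _ u Lu).
  pose f (e : {x | L x} * {x | L x}) := (sval e.1, sval e.2).
  have inj : injective f.
    by move=> [s t] [s' t'] [/sval_inj-> /sval_inj->].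
  apply: sub_finite_set (finite_preimage (f := f) (fun _ _ _ _ => @inj _ _) fK).
  move=> [s t] [Est nC]; split=> //=.
  by split=> //; [exact: (svalP s)|exact: (svalP t)].
have [[a' pa'] [[b' pb'] [[x Lx] [D [ab' Dx [[y Ly] Dy yx] [[z Lz] Dz] cross]]]]] :=
  cut_pair Esym Econn (ex_intro _ C cutC).
(* the preimage of the cut D under the projection onto L *)
pose hat w := exists u (pu : L u), prj A L w u /\ D (exist _ u pu).
have hatE u (pu : L u) : hat u <-> D (exist _ u pu).
  split=> [[v [pv [pr Dv]]]|Du]; last first.
    by exists u, pu; split=> //; apply: prj_id.
  by have e := prj_in pr pu; subst v; rewrite (Prop_irrelevance pu pv).
have ne u v (pu : L u) (pv : L v) : exist L u pu <> exist L v pv -> u <> v.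
  by move=> uv e; apply: uv; apply: sval_inj.
have nab : a' <> b' by exact: ne ab'.
have edge g : G g -> g a' <> x -> g b' <> x ->
    off A x (g a') (g b') /\ (hat (g a') <-> hat (g b')).
  move=> Gg gax gbx.
  have [g' [Gg' gK g'K]] := group_inv G_group Gg.
  have lgL := lobe_image G_group (a := a) (b := b) Gg lL.
  have La : (g @` L) (g a') by exists a'.
  have Lb : (g @` L) (g b') by exists b'.
  have gab : g a' <> g b' by move=> /(can_inj gK).
  split.
    have [_ h] := lobe_colobal Asym lgL La Lb gab.
    by apply: h; exact: nesym.
  have [gL|gL] := pselect (L = g @` L); last first.
    have tr w w' : (g @` L) w -> (g @` L) w' -> hat w -> hat w'.
      move=> Lw Lw' [u [pu [pw Du]]]; exists u, pu; split=> //.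
      exact: (prj_lobe Asym Airr Aconn lL lgL gL Lw Lw' pw).
    by split; apply: tr.
  have sg : set_stabiliser G L g by [].
  have [k [sk gk kg]] := set_stabiliser_inv G_group sg.
  pose h (s : {x | L x}) : {x | L x} :=
    exist _ (g (sval s)) (set_stabiliser_mem sg (svalP s)).
  pose h' (s : {x | L x}) : {x | L x} :=
    exist _ (k (sval s)) (set_stabiliser_mem sk (svalP s)).
  have [_ [_ _ Ag]] := orbital_automorphism G_group a b Gg.
  have aut : automorphism E h.
    exists h'; split=> [s|s|s t]; last exact: Ag.
      by apply: sval_inj; rewrite /= gk.
    by apply: sval_inj; rewrite /= kg.
  rewrite -!gL in La Lb.
  rewrite (hatE _ La) (hatE _ Lb).
  have -> : exist _ (g a') La = h (exist _ a' pa') by apply: sval_inj.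
  have -> : exist _ (g b') Lb = h (exist _ b' pb') by apply: sval_inj.
  apply: contrapT => nD.
  by have [|] := cross h aut nD => /(congr1 sval) /= e; [case: gax|case: gbx].
have step u v : orbital G a' b' u v -> u <> x -> v <> x ->
    off A x u v /\ (hat u <-> hat v).
  move=> [g Gg [[-> ->]|[-> ->]]] ux vx; first exact: edge.
  have [h1 h2] := edge g Gg vx ux; split; first exact: off_sym.
  by rewrite h2.
exists a', b', x, y, z; split=> //; split.
  split=> //; first exact: ne yx.
  by move=> zx; subst z; apply: Dz; rewrite (Prop_irrelevance Lz Lx).
split.
  move=> yz.
  have : hat z.
    apply: (@conn_invariant _ _ hat _ y z _ yz); last exact/hatE.
    by move=> u v ux vx /step -/(_ ux vx)[_ ->].
  by rewrite (hatE _ Lz).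
move=> u v; apply: conn_rel_sub => // s t sx tx /step -/(_ sx tx)[h _].
exact: h.
Qed.

(** * Ends and cuts *)

Section Ends.
Variables (T : Type) (D : digraph T).
Implicit Types (F : set T) (r s t : nat -> T).

Lemma adjacent_sym x y : adjacent D x y -> adjacent D y x.
Proof. by case; [right|left]. Qed.

Lemma adjacent_vertices x y : adjacent D x y -> vertices D x /\ vertices D y.
Proof. by case=> xy; have [] := arcs_vertices xy. Qed.

Lemma upath_conn (P : set T) n p : upath D n p ->
  (forall i, i <= n -> P (p i)) -> conn (adjacent D) P (p 0) (p n).
Proof.
move=> [_ padj] Pp; elim: n padj Pp => [|n IHn] padj Pp.
  by apply: conn_refl; apply: Pp.
apply: (@conn_trans _ _ _ _ (p n)).
  by apply: IHn => i ni; [apply: padj; apply: ltnW|apply: Pp; apply: leqW].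
by apply: conn_edge; [apply: Pp|apply: Pp|apply: padj].
Qed.

Lemma conn_upath (P : set T) x y : vertices D y -> conn (adjacent D) P x y ->
  exists n p, [/\ upath D n p, p 0 = x, p n = y & forall i, i <= n -> P (p i)].
Proof.
move=> + xy; elim: xy => [z Pz Dz|u v w Pu Auv vw IH Dw].
  by exists 0, (fun=> z).
have [n [p [[pD padj] p0 pn Pp]]] := IH Dw.
exists n.+1, (fun i => if i is j.+1 then p j else u); split=> //.
  split=> [[_|i]|[_|i]]; rewrite ?p0 //.
  - by case: (adjacent_vertices Auv).
  - exact: pD.
  - exact: padj.
by case=> // i; apply: Pp.
Qed.

Lemma half_line_vertices r i : half_line D r -> vertices D (r i).
Proof. by move=> [_ radj]; case: (adjacent_vertices (radj i)). Qed.

Lemma half_line_leaves r F : half_line D r -> finite_set F ->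
  exists N, forall i, N <= i -> ~ F (r i).
Proof.
move=> [rinj _] finF.
have fin : finite_set (r @^-1` F).
  by apply: finite_preimage => // i j _ _ /rinj.
have [X eX] := finite_fsetP.1 fin.
exists (\max_(i <- X) i).+1 => i Xi Fi.
have iX : i \in X by have : [set` X] i by rewrite -eX.
by have := leq_trans Xi (leq_bigmax_seq (F := id) i iX isT); rewrite ltnn.
Qed.

Lemma half_line_tail (P : set T) r i j : half_line D r ->
  (forall k, i <= k -> P (r k)) -> i <= j -> conn (adjacent D) P (r i) (r j).
Proof.
move=> [_ radj] Pr; elim: j => [|j IHj].
  by rewrite leqn0 => /eqP i0; rewrite i0 in Pr *; apply: conn_refl; apply: Pr.
rewrite leq_eqVlt => /predU1P[<-|]; first by apply: conn_refl; apply: Pr.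
rewrite ltnS => ij; apply: conn_trans (IHj ij) _.
by apply: conn_edge; [exact: Pr|apply/Pr/leqW|exact: radj].
Qed.

(** For half-lines this is equivalent to [half_line_equiv], and more easily seen
    to be transitive. *)
Definition inseparable r s : Prop := forall F, finite_set F ->
  exists i j, conn (adjacent D) (~` F) (r i) (s j).

Lemma inseparable_sym r s : inseparable r s -> inseparable s r.
Proof.
move=> rs F /rs[i [j rsij]]; exists j, i.
exact: conn_sym adjacent_sym _.
Qed.

Lemma inseparable_trans r s t : half_line D s ->
  inseparable r s -> inseparable s t -> inseparable r t.
Proof.
move=> hs rs st F finF; have [N NF] := half_line_leaves hs finF.
have finF1 : finite_set (F `|` s @` `I_N).
  by rewrite finite_setU; split=> //; apply: finite_image; apply: finite_II.
have [i [j rij]] := rs _ finF1; have [k [l skl]] := st _ finF1.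
have late m : (~` (F `|` s @` `I_N)) (s m) -> N <= m.
  by move=> nF; rewrite leqNgt; apply/negP => mN; apply: nF; right; exists m.
have Nj : N <= j by apply: late; case: (conn_ends rij).
have Nk : N <= k by apply: late; case: (conn_ends skl).
have sub : forall z, (~` (F `|` s @` `I_N)) z -> (~` F) z.
  by move=> z nz Fz; apply: nz; left.
exists i, l; apply: conn_trans (conn_sub sub rij) _.
apply: conn_trans (conn_sub sub skl).
have tail m m' : N <= m -> m <= m' -> conn (adjacent D) (~` F) (s m) (s m').
  move=> Nm; apply: half_line_tail => // n mn.
  by apply: NF; apply: leq_trans mn.
have [jk|/ltnW kj] := leqP j k; first exact: tail.
by apply: (conn_sym adjacent_sym); apply: tail.
Qed.

(** A finite set meets only finitely many of infinitely many disjoint paths. *)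
Lemma half_line_equiv_inseparable r s : half_line_equiv D r s -> inseparable r s.
Proof.
move=> [n [P [Ppath Pdisj]]] F finF.
suff [k kF] : exists k, forall i, i <= n k -> ~ F (P k i).
  have [up [i _ ri] [j _ sj]] := Ppath k.
  by exists i, j; rewrite ri sj; apply: upath_conn.
apply: contrapT => all_meet.
have : forall k, exists z, F z /\ upath_vertices (n k) (P k) z.
  move=> k; apply: contrapT => nz; apply: all_meet; exists k => i ik Fi.
  by apply: nz; exists (P k i); split=> //; exists i.
move=> /choice[z zP]; apply: infinite_nat.
have inj : {in setT &, injective z}.
  move=> k l _ _ e; apply: (Pdisj k l) => //.
  exists (z k); split; first by case: (zP k).
  by rewrite e; case: (zP l).
rewrite -(eq_finite_set (inj_card_eq inj)).
by apply: sub_finite_set finF => _ [k _ <-]; case: (zP k).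
Qed.

(** The paths are chosen one after the other, each off the finitely many vertices
    of the previous ones. *)
Lemma inseparable_half_line_equiv r s : half_line D r -> half_line D s ->
  inseparable r s -> half_line_equiv D r s.
Proof.
move=> hr hs rs.
have : forall F, exists np : nat * (nat -> T), finite_set F ->
    [/\ upath D np.1 np.2, range r (np.2 0), range s (np.2 np.1) &
        forall i, i <= np.1 -> ~ F (np.2 i)].
  move=> F; have [finF|nF] := pselect (finite_set F); last first.
    by exists (0, r).
  have [i [j rij]] := rs F finF.
  have [n [p [up p0 pn pF]]] := conn_upath (half_line_vertices j hs) rij.
  by exists (n, p) => _; split=> //=; [exists i|exists j].
move=> /choice[path pathP].
pose verts F := upath_vertices (path F).1 (path F).2.
pose U := fix U k := if k is l.+1 then U l `|` verts (U l) else set0.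
have finU k : finite_set (U k).
  elim: k => [|k IHk] /=; first exact: finite_set0.
  by rewrite finite_setU; split=> //; apply: finite_image; apply: finite_II.
have Umono k l : k < l -> verts (U k) `<=` U l.
  elim: l => // l IHl; rewrite ltnS leq_eqVlt => /predU1P[->|/IHl kl] z Vz /=.
    by right.
  by left; apply: kl.
exists (fun k => (path (U k)).1), (fun k => (path (U k)).2); split.
  by move=> k; have [] := pathP _ (finU k).
have no k l : k < l -> forall z, verts (U k) z -> ~ verts (U l) z.
  move=> kl z kz [i il ez]; have [_ _ _ avoid] := pathP _ (finU l).
  apply: (avoid i); first by rewrite -ltnS.
  by rewrite ez; apply: (Umono k).
move=> k l _ _ [z [kz lz]].
by have [kl|lk|//] := ltngtP k l; [case: (no _ _ kl z)|case: (no _ _ lk z)].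
Qed.

Lemma ends_separable e e' : ends D e -> ends D e' -> e <> e' ->
  exists r s F, [/\ half_line D r, half_line D s, finite_set F &
    forall i j, ~ conn (adjacent D) (~` F) (r i) (s j)].
Proof.
move=> [r hr <-] [s hs <-] ne.
have [rs|nrs] := pselect (inseparable r s).
  case: ne; have half r' s' : half_line D r' -> half_line D s' ->
      inseparable r' s' -> end_class D r' `<=` end_class D s'.
    move=> hr' hs' rs' t [ht /half_line_equiv_inseparable rt]; split=> //.
    apply: inseparable_half_line_equiv => //.
    exact: (inseparable_trans hr' (inseparable_sym rs')).
  by apply/seteqP; split; apply: half => //; apply: inseparable_sym.
have [F nF] : exists F, ~ (finite_set F ->
    exists i j, conn (adjacent D) (~` F) (r i) (s j)).
  by apply/existsNP.
have finF : finite_set F by apply: contrapT => nfin; apply: nF => /nfin.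
by exists r, s, F; split=> // i j rij; apply: nF => _; exists i, j.
Qed.

(** A finite vertex set [F] separating two half-lines gives a cut with finite
    boundary: the part of the digraph reached from one half-line outside [F]. *)
Lemma ends_cut e e' : locally_finite D -> ends D e -> ends D e' -> e <> e' ->
  exists K : set T, [/\ K `<=` vertices D, infinite_set K,
    infinite_set (vertices D `\` K) & finite_set (boundary (adjacent D) K)].
Proof.
move=> lf De De' ne; have [r [s [F [hr hs finF sep]]]] := ends_separable De De' ne.
pose K := [set v | exists i, conn (adjacent D) (~` F) (r i) v].
have ray t : half_line D t -> infinite_set (range t `\` F).
  move=> [tinj _]; apply: infinite_setD => //.
  have inj : {in setT &, injective t} by move=> ? ? _ _ /tinj.
  rewrite (eq_finite_set (inj_card_eq inj)); exact: infinite_nat.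
have KD : K `<=` vertices D.
  move=> v [i iv]; apply: (@conn_invariant _ _ (vertices D) _ _ _ _ iv).
    by move=> u w _ _ /adjacent_vertices[].
  exact: half_line_vertices.
exists K; split=> //.
- apply: sub_infinite_set (ray r hr) => _ [[i _ <-] nF].
  by exists i; apply: conn_refl.
- apply: sub_infinite_set (ray s hs) => _ [[j _ <-] nF].
  by split; [exact: half_line_vertices|move=> [i /sep]].
pose N := \bigcup_(v in F `&` vertices D) [set w | adjacent D v w].
have finN : finite_set N.
  apply: bigcup_finite => [|v [_ Dv]]; last exact: lf.
  by apply: sub_finite_set finF => v [].
apply: (@sub_finite_set _ _ ((F `*` N) `|` (N `*` F))); last first.
  by rewrite finite_setU; split; apply: finite_setX.
have out u v : adjacent D u v -> K u -> ~ K v -> F v.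
  move=> Auv [i iu] nKv; apply: contrapT => nFv; apply: nKv; exists i.
  have [_ nFu] := conn_ends iu.
  by apply: conn_trans iu _; apply: conn_edge.
have nbr u v : adjacent D u v -> F u -> N v.
  by move=> Auv Fu; exists u => //; split=> //; case: (adjacent_vertices Auv).
move=> [u v] [/= Auv nK].
have Avu := adjacent_sym Auv.
have [Ku|nKu] := pselect (K u); have [Kv|nKv] := pselect (K v).
- by case: nK.
- by right; split=> /=; [apply: (nbr v) => //|]; apply: (out u).
- by left; split=> /=; [|apply: (nbr u) => //]; apply: (out v).
- by case: nK; split=> [/nKu|/nKv].
Qed.

End Ends.

(** * Lobes as subdigraphs *)

Lemma card_le_one (T : Type) (W : set T) :
  W #<= `I_1 <-> forall x y, W x -> W y -> x = y.
Proof.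
split=> [W1 x y Wx Wy|W1].
  apply: contrapT => xy.
  suff : `I_2 #<= W by move=> /card_le_trans/(_ W1); rewrite card_le_II.
  apply: (card_ge_II (e := fun i => if i is 0 then x else y)) => [[|i]|[|i] [|j]] //=.
  - by move=> _ _ /esym.
  - by rewrite !ltnS !leqn0 => /eqP-> /eqP->.
have [->|/set0P[x Wx]] := eqVneq W set0; first exact: card_ge0.
rewrite (_ : W = [set x]); last first.
  by apply/seteqP; split=> [y Wy|_ ->//]; apply: W1.
by rewrite (card_le_eql card_set1) card_lexx.
Qed.

Section LobeDigraph.
Variables (T : Type) (D : digraph T).
Hypothesis DT : vertices D = setT.
Let A := adjacent D.
Hypothesis Aconn : forall x y, conn A setT x y.

Let Asym x y : A x y -> A y x.
Proof. exact: adjacent_sym. Qed.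

Lemma adjacent_irr x : ~ A x x.
Proof. by case; apply: arcs_loopless. Qed.

Lemma block_colobal B x y : subdigraph B D -> block B -> vertices B x ->
  vertices B y -> x <> y -> colobal A x y.
Proof.
move=> [_ BD] [_ _ Bcut] Bx By xy; split=> // z zx zy.
pose W := [set t | vertices B t /\ t = z].
have W1 : W #<= `I_1 by apply/card_le_one => u v [_ ->] [_ ->].
have conn_BW : connected_digraph (delete_vertices B W).
  apply: contrapT => nconn; apply: (Bcut W) => //.
  by split=> // t [].
have xBW : vertices (delete_vertices B W) x by split=> // -[_ ezx]; apply: zx.
have yBW : vertices (delete_vertices B W) y by split=> // -[_ ezy]; apply: zy.
have [n [p [[pBW padj] <- <-]]] := conn_BW x y xBW yBW.
have : conn (adjacent (delete_vertices B W)) (~` [set z]) (p 0) (p n).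
  apply: upath_conn => // i /pBW[Bpi nW] piz.
  by apply: nW.
apply: conn_rel_sub => // u v uz vz Buv; apply: conn_edge => //.
by case: Buv => -[/BD Duv _ _]; [left|right].
Qed.

Definition induced (S : set T) : digraph T := delete_vertices D (~` S).

Lemma induced_vertices S : vertices (induced S) = S.
Proof.
by rewrite /= DT setTD setCK.
Qed.

Lemma induced_arcs S x y : S x -> S y -> arcs D (x, y) -> arcs (induced S) (x, y).
Proof.
by move=> Sx Sy Dxy; split=> //=; split=> [|nS]; rewrite ?DT //; apply: nS.
Qed.

Lemma conn_connected (E : digraph T) (P : set T) :
    vertices E = P -> (forall x y, P x -> P y -> A x y -> adjacent E x y) ->
    (forall x y, P x -> P y -> conn A P x y) ->
  connected_digraph E.
Proof.
move=> <- AE AP x y Ex Ey.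
have [|n [p [up p0 pn _]]] := @conn_upath _ E (vertices E) x y Ey.
  apply: conn_rel_sub (AP x y Ex Ey) => // u v Eu Ev Auv.
  by apply: conn_edge => //; apply: AE.
by exists n, p.
Qed.

Lemma lobe_block S : is_lobe A S -> block (induced S).
Proof.
move=> lS; have VS := induced_vertices S; split.
- apply: (conn_connected VS) => x y Sx Sy.
    by case=> Dxy; [left|right]; apply: induced_arcs.
  exact: (lobe_conn Asym adjacent_irr Aconn lS).
- have [x [y [Sx Sy xy]]] := lobe_two lS; rewrite VS.
  apply: (card_ge_II (e := fun i => if i is 0 then x else y)) => [[|i]|[|i] [|j]] //=.
  by move=> _ _ /esym.
  by rewrite !ltnS !leqn0 => /eqP-> /eqP->.
move=> W [WS nconn] /card_le_one W1; apply: nconn.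
rewrite VS in WS.
apply: (conn_connected (P := S `\` W)).
- by rewrite /= -{2}VS.
- move=> x y [Sx nWx] [Sy nWy] [Dxy|Dyx]; [left|right]; split; rewrite ?VS //;
  exact: induced_arcs.
- move=> x y [Sx nWx] [Sy nWy].
  have [[z Wz]|W0] := pselect (exists z, W z).
    have eW : W = [set z] by apply/seteqP; split=> [t Wt|_ ->//]; apply: W1.
    by rewrite eW in nWx nWy *; apply: (lobe_conn_off Asym adjacent_irr lS).
  apply: conn_sub (lobe_conn Asym adjacent_irr Aconn lS Sx Sy) => t St.
  by split=> // Wt; apply: W0; exists t.
Qed.

(** Any two vertices of a block are colobal, so a block lies in some
    [lobe_through x y]; conversely the latter induces a block, and maximality
    gives equality. *)
Lemma lobe_digraph L : lobe D L -> is_lobe A (vertices L) /\ L = induced (vertices L).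
Proof.
move=> [LD bL Lmax]; have [_ L2 _] := bL.
have [x [y [Lx Ly xy]]] : exists x y, [/\ vertices L x, vertices L y & x <> y].
  apply: contrapT => no2.
  suff /(card_le_trans L2) : vertices L #<= `I_1 by rewrite card_le_II.
  apply/card_le_one => x y Lx Ly; apply: contrapT => xy.
  by apply: no2; exists x, y.
have col := block_colobal LD bL.
have [lS Sx Sy] := colobal_lobe (col x y Lx Ly xy).
set S := lobe_through A x y in lS Sx Sy.
have LS : vertices L `<=` S.
  move=> z Lz; have [->//|zx] := pselect (z = x).
  have [->//|zy] := pselect (z = y).
  by apply: Or33; split; apply: col.
have SL : induced S = L.
  apply: Lmax; last split.
  - by split; [rewrite DT|move=> e []].
  - exact: lobe_block.
  - by rewrite induced_vertices.
  - move=> [u v] Luv; have [Lu Lv] := arcs_vertices Luv; have [_ LDa] := LD.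
    by apply: induced_arcs; [exact: LS|exact: LS|exact: LDa].
have eL : vertices L = S by rewrite -SL induced_vertices.
by rewrite eL SL.
Qed.

End LobeDigraph.

(** * Orbital digraphs *)

Lemma adjacent_orbital (T : Type) (G : set (T -> T)) (D : digraph T) a b :
  arcs D = [set (g a, g b) | g in G] -> adjacent D = orbital G a b.
Proof.
move=> aD; apply/funext => x; apply/funext => y; apply/propext.
rewrite /adjacent aD; split=> [[[g Gg [<- <-]]|[g Gg [<- <-]]]|[g Gg]].
- by exists g => //; left.
- by exists g => //; right.
- by case=> -[-> ->]; [left|right]; exists g.
Qed.

Section OrbitalDigraph.
Variables (T : Type) (G : set (T -> T)).
Hypothesis G_group : permutation_group G.
Variables (a b : T).
Hypothesis ab : a <> b.

Let arcs_ab : set (T * T) := [set (g a, g b) | g in G].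

Fact orbital_arcs_vertices x y : arcs_ab (x, y) -> [set: T] x /\ [set: T] y.
Proof. by []. Qed.

Fact orbital_arcs_loopless x : ~ arcs_ab (x, x).
Proof.
move=> [g Gg [gax gbx]]; apply: (orbital_irr G_group ab (x := x)).
by exists g => //; left.
Qed.

Definition orbital_dg : digraph T :=
  Digraph orbital_arcs_vertices orbital_arcs_loopless.

Lemma orbital_dgP : orbital_digraph G orbital_dg.
Proof. by split=> //; exists a, b. Qed.

End OrbitalDigraph.

Lemma orbital_locally_finite (T : Type) (G : set (T -> T)) (D : digraph T) :
    permutation_group G -> no_infinite_subdegree G -> orbital_digraph G D ->
  locally_finite D.
Proof.
move=> G_group fin [_ [a [b [ab aD]]]] x _; rewrite (adjacent_orbital aD).
have half c d : finite_set [set y | exists2 g, G g & x = g c /\ y = g d].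
  have [[g [Gg xg]]|no] := pselect (exists g, G g /\ x = g c); last first.
    apply: sub_finite_set (finite_set0 T) => y [g Gg [xg _]].
    by apply: no; exists g.
  have [h [Gh gK hK]] := group_inv G_group Gg.
  apply: sub_finite_set (fin x (g d)) => y [k Gk [xk ->]].
  exists (fun t => k (h t)); last by rewrite gK.
  split; first exact: (group_comp G_group).
  by rewrite {1}xg gK -xk.
apply: (@sub_finite_set _ _ ([set y | exists2 g, G g & x = g a /\ y = g b] `|`
                             [set y | exists2 g, G g & x = g b /\ y = g a])).
  by move=> y [g Gg [e|e]]; [left|right]; exists g.
by rewrite finite_setU; split; apply: half.
Qed.

Lemma primitive_onS (T : Type) (G H : set (T -> T)) V :
  G `<=` H -> primitive_on G V -> primitive_on H V.
Proof.
move=> GH [tr prim]; split=> [x y Vx Vy|R eR iR].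
  by have [g /GH] := tr x y Vx Vy; exists g.
by apply: prim => // g x y /GH; apply: iR.
Qed.

(** Refining the graph along a lobe never merges branches, and it splits the
    branch at [x'] that contains the rest of the lobe. *)
Lemma more_branches (T : Type) (G : set (T -> T)) (a b : T) (L K : set T) k x f :
    permutation_group G -> primitive_on G [set: T] -> a <> b ->
    is_lobe (orbital G a b) L -> 0 < k -> branches (orbital G a b) k x f ->
    K `<=` L -> infinite_set K -> infinite_set (L `\` K) ->
    finite_set [set e | orbital G a b e.1 e.2 /\
                        [/\ L e.1, L e.2 & ~ (K e.1 <-> K e.2)]] ->
  exists a' b' x' f', a' <> b' /\ branches (orbital G a' b') k.+1 x' f'.
Proof.
move=> G_group G_primitive ab lL k0 fk KL iK iK' fK.
have [a' [b' [x' [y [z [ab' [[Lx Ly Lz yx zx] [yz sub]]]]]]]] :=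
  refine_lobe G_group G_primitive ab lL KL iK iK' fK.
have [h [hx hinj]] := branches_move G_group G_primitive x' fk.
have Asym := @orbital_sym T G a b.
have Asym' := @orbital_sym T G a' b'.
have yzA : off (orbital G a b) x' y z.
  have := lobe_conn_off Asym (orbital_irr G_group ab) lL Ly Lz yx zx.
  by apply: conn_sub => t [].
(* y and z replace the representative of the branch that contains both *)
have [i0 [i0k i0P]] : exists i0, i0 < k /\
    forall i, i < k -> i <> i0 -> ~ off (orbital G a b) x' (h i) y.
  have [[i [ik iy]]|no] := pselect (exists i, i < k /\ off (orbital G a b) x' (h i) y).
    exists i; split=> // j jk ji jy; apply: ji; apply: hinj => //.
    by apply: off_trans jy _; apply: (off_sym Asym).
  by exists 0; split=> // i ik _ iy; apply: no; exists i.
pose h' i := if i == i0 then y else if i == k then z else h i.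
exists a', b', x', h'; split=> //.
have ki0 : (k == i0) = false by apply/eqP=> e; rewrite e ltnn in i0k.
have h'i i : i < k.+1 -> [\/ i = i0 /\ h' i = y, i = k /\ h' i = z |
    [/\ i < k, i <> i0 & h' i = h i]].
  move=> ik1; rewrite /h'; have [->|/eqP ii0] := eqVneq i i0; first by apply: Or31.
  have [->|/eqP ik] := eqVneq i k; first by apply: Or32; split=> //; rewrite ?ki0 ?eqxx.
  by move: ik1; rewrite ltnS leq_eqVlt => /predU1P[//|ik']; apply: Or33.
split=> [i ik|i j ik jk].
  by case: (h'i i ik) => [[_ ->]|[_ ->]|[ik' _ ->]] //; exact: hx.
have hy i' : i' < k -> i' <> i0 -> ~ off (orbital G a' b') x' (h i') y.
  by move=> ik' ii0 /sub; apply: i0P.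
have hz i' : i' < k -> i' <> i0 -> ~ off (orbital G a' b') x' (h i') z.
  move=> ik' ii0 /sub iz; apply: (i0P i') => //.
  by apply: off_trans iz _; apply: (off_sym Asym).
case: (h'i i ik) => [[-> ->]|[-> ->]|[ik' ii0 ->]];
case: (h'i j jk) => [[-> ->]|[-> ->]|[jk' ji0 ->]] //.
- by move=> /(off_sym Asym') /hy; case.
- by move=> /(off_sym Asym') /yz.
- by move=> /(off_sym Asym') /hz; case.
- by move=> /hy; case.
- by move=> /hz; case.
- by move=> /sub; apply: hinj.
Qed.

(** * Orbital graphs with a maximal number of branches *)

Lemma maximal_branches (T : Type) (G : set (T -> T)) (a0 b0 : T) :
    permutation_group G -> primitive_on G [set: T] -> no_infinite_subdegree G ->
    a0 <> b0 ->
  exists a b k x f, [/\ a <> b, 0 < k, branches (orbital G a b) k x f &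
    forall a' b' k' x' f', a' <> b' -> branches (orbital G a' b') k' x' f' ->
      k' <= k].
Proof.
move=> G_group G_primitive fin ab0.
pose P k := `[< exists a b x f, a <> b /\ branches (orbital G a b) k x f >].
have P1 : P 1.
  apply/asboolP; exists a0, b0, a0, (fun=> b0); split=> //; split=> [_ _ /esym//|i j].
  by rewrite !ltnS !leqn0 => /eqP-> /eqP->.
have bound k : P k -> k <= (ncard (Defs.orbit (point_stabiliser G a0) b0)).+1.
  move=> /asboolP[a [b [x [f [ab fk]]]]].
  have [h hk] := branches_move G_group G_primitive a0 fk.
  exact: (branches_bound G_group G_primitive ab (nesym ab0) (fin a0 b0) hk).
have [k /asboolP[a [b [x [f [ab fk]]]]] kmax] := ex_maxnP (ex_intro _ 1 P1) bound.
exists a, b, k, x, f; split=> //; first exact: kmax.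
move=> a' b' k' x' f' ab' fk'; apply: kmax; apply/asboolP.
by exists a', b', x', f'.
Qed.

Theorem theorem3p11 (Omega : Type) (G : set (Omega -> Omega))
    (Omega_infinite : infinite_set [set: Omega])
    (G_group : permutation_group G)
    (G_primitive : primitive_on G [set: Omega])
    (G_ends : more_than_one_permutation_end G)
    (G_subdegrees : no_infinite_subdegree G) :
  exists Gamma : digraph Omega,
    [/\ orbital_digraph G Gamma,
        locally_finite Gamma,
        has_connectivity Gamma 1,
        (forall L, lobe Gamma L ->
           [/\ primitive_digraph L,
               ~ automorphism_regular L,
               `I_3 #<= vertices L &
               at_most_one_end L]) /\
        (forall L L', lobe Gamma L -> lobe Gamma L' -> isomorphic L L') &
        forall L, lobe Gamma L ->
          primitive_on (set_stabiliser G (vertices L)) (vertices L) /\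
          ~ regular_on (set_stabiliser G (vertices L)) (vertices L)].
Proof.
have [D [orbD [e [e' [De De' ee']]]]] := G_ends.
have [DT [a0 [b0 [ab0 aD]]]] := orbD.
have [a [b [k [x [f [ab k0 fk kmax]]]]]] :=
  maximal_branches G_group G_primitive G_subdegrees ab0.
have k1 : 1 < k.
  (* otherwise D is a single lobe, in which the two ends give a cut *)
  rewrite ltnNge; apply/negP => k1.
  have lT : is_lobe (orbital G a0 b0) setT.
    exists a0, b0.
    have col u v : u <> v -> colobal (orbital G a0 b0) u v.
      move=> uv; split=> // z zu zv; apply: contrapT => nuv.
      suff /(kmax _ _ _ _ _ ab0) : branches (orbital G a0 b0) 2 z
          (fun i => if i is 0 then u else v) by rewrite leqNgt ltnS k1.
      split=> [[|i] _|[|[|i]] [|[|j]] //= _ _]; try exact: nesym.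
      by move=> hvu; case: nuv; apply: off_sym hvu; exact: orbital_sym.
    split; first exact: col.
    apply/seteqP; split=> // z _.
    have [->|za] := pselect (z = a0); first exact: Or31.
    have [->|zb] := pselect (z = b0); first exact: Or32.
    by apply: Or33; split; apply: col.
  have lfD := orbital_locally_finite G_group G_subdegrees orbD.
  have [K [KD iK iK' fK]] := ends_cut lfD De De' ee'.
  rewrite DT in KD iK'; rewrite (adjacent_orbital aD) in fK.
  have [] := more_branches (k := 1) (x := a0) (f := fun=> b0) (K := K)
    G_group G_primitive ab0 lT.
  - by [].
  - split=> [_ _ /esym//|i j]; by rewrite !ltnS !leqn0 => /eqP-> /eqP->.
  - by [].
  - by [].
  - by [].
  - by apply: sub_finite_set fK => p [Ap [_ _ nK]].
  move=> a' [b' [x' [f' [ab' /(kmax _ _ _ _ _ ab')]]]].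
  by rewrite leqNgt ltnS k1.
have cx := branches_cut_point k1 fk.
pose Gamma := orbital_dg G_group ab.
have adjE : adjacent Gamma = orbital G a b by exact: adjacent_orbital.
have orbG : orbital_digraph G Gamma := orbital_dgP G_group ab.
have lfG := orbital_locally_finite G_group G_subdegrees orbG.
have Asym := @orbital_sym Omega G a b.
have Airr := orbital_irr G_group ab.
have Aconn := orbital_conn G_group G_primitive ab.
have AconnG : forall u v, conn (adjacent Gamma) setT u v by rewrite adjE.
have lobeG L : lobe Gamma L ->
    is_lobe (orbital G a b) (vertices L) /\ L = induced Gamma (vertices L).
  by move=> lL; rewrite -adjE; apply: lobe_digraph.
have adjL L u v : lobe Gamma L -> adjacent L u v ->
    [/\ orbital G a b u v, vertices L u & vertices L v].
  move=> [[_ LG] _ _] Luv; have [Lu Lv] := adjacent_vertices Luv.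
  by split=> //; rewrite -adjE; case: Luv => /LG; [left|right].
have arcsL L u v : lobe Gamma L -> vertices L u -> vertices L v ->
    arcs L (u, v) <-> arcs Gamma (u, v).
  move=> lL Lu Lv; have [[_ LG] _ _] := lL; split; first exact: LG.
  by have [_ eL] := lobeG L lL; move=> Guv; rewrite eL; apply: induced_arcs.
have isoL g L L' : lobe Gamma L -> lobe Gamma L' -> G g ->
    g @` vertices L = vertices L' -> isomorphism L L' g.
  move=> lL lL' Gg gL; have [h [Gh gK hK]] := group_inv G_group Gg.
  have mem t : vertices L t -> vertices L' (g t) by move=> Lt; rewrite -gL; exists t.
  split; first split=> //.
  - by move=> u v _ _ /(can_inj gK).
  - by rewrite -gL.
  move=> u v Lu Lv; rewrite arcsL // arcsL //; try exact: mem.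
  split=> -[c Gc [e1 e2]].
    exists (fun t => g (c t)); first exact: (group_comp G_group).
    by rewrite e1 e2.
  exists (fun t => h (c t)); first exact: (group_comp G_group).
  by rewrite e1 e2 !gK.
have stab_aut L : lobe Gamma L ->
    set_stabiliser G (vertices L) `<=` automorphisms L.
  by move=> lL g [Gg gL]; apply: isoL.
exists Gamma; split=> //.
- split.
    exists [set x]; split; last exact: card_set1.
    split=> // con; have [y [z [yx zx nyz]]] := cx; apply: nyz.
    have [//|//|n [p [[pV padj] <- <-]]] := con y z.
    have : conn (adjacent (delete_vertices Gamma [set x])) (~` [set x]) (p 0) (p n).
      by apply: upath_conn => // i /pV[].
    apply: conn_rel_sub => // u v ux vx uv; apply: conn_edge => //.
    by rewrite -adjE; case: uv => -[uv _ _]; [left|right].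
  move=> W [_ ncon]; have [[w Ww]|W0] := pselect (exists w, W w).
    by apply: (card_ge_II (e := fun=> w)) => // -[|i] [|j].
  case: ncon; apply: (@conn_connected _ Gamma _ setT) => //.
  - by apply/seteqP; split=> // t _; split=> // Wt; apply: W0; exists t.
  - move=> u v _ _ [uv|vu]; [left|right]; split=> //; split=> // Wt; apply: W0;
    by [exists u|exists v].
- split=> [L lL|L L' lL lL'].
    have [lobL _] := lobeG L lL.
    have [u [v [w [[Lu Lv Lw] [uv uw vw]]]]] :=
      lobe_three G_group G_primitive ab cx lobL.
    split.
    + apply: primitive_onS (stab_aut L lL) _.
      exact: (lobe_stabiliser_primitive G_group G_primitive ab cx lobL).
    + move=> [_ fix1].
      apply: (lobe_stabiliser_not_regular G_group G_primitive ab cx lobL).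
      split; first exact: (lobe_stabiliser_transitive G_group G_primitive ab cx lobL).
      by move=> s g Ls /(stab_aut L lL); apply: fix1.
    + apply: (card_ge_II (e := fun i => match i with 0 => u | 1 => v | _ => w end)).
        by move=> [|[|i]].
      move=> [|[|[|i]]] [|[|[|j]]] //=; try by move=> _ _ /esym.
    + move=> d d' Ld Ld'; apply: contrapT => dd'.
      have lfL : locally_finite L.
        move=> s Ls; apply: (sub_finite_set _ (lfG s I)) => t /(adjL _ _ _ lL)[].
        by rewrite -adjE.
      have [K [KL iK iK' fK]] := ends_cut lfL Ld Ld' dd'.
      have [] := more_branches G_group G_primitive ab lobL k0 fk KL iK iK'.
        apply: sub_finite_set fK => -[s t] [/= Ast [Ls Lt nK]]; split=> //=.
        by move: Ast; rewrite -adjE => -[] Gst; [left|right]; apply/arcsL.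
      move=> a' [b' [x' [f' [ab' /(kmax _ _ _ _ _ ab')]]]].
      by rewrite ltnn.
  have [lobL _] := lobeG L lL; have [lobL' _] := lobeG L' lL'.
  have [g Gg gL] := lobe_transitive G_group G_primitive ab lobL lobL'.
  by exists g; apply: isoL.
- move=> L lL; have [lobL _] := lobeG L lL; split.
    exact: (lobe_stabiliser_primitive G_group G_primitive ab cx lobL).
  exact: (lobe_stabiliser_not_regular G_group G_primitive ab cx lobL).
Qed.
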